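(* For any flag $n$-dimensional nestohedron $P_B$ one has $0\le\gamma_i(P_B)\le\gamma_i(Pe^n)$ for all $i=0,\dots,\lfloor n/2\rfloor$.
   Context: Write $[m]=\{1,\dots,m\}$. A building set on $[m]$ is a collection $B$ of nonempty subsets of $[m]$ such that (i) $\{i\}\in B$ for all $i\in[m]$; (ii) if $S_1,S_2\in B$ and $S_1\cap S_2\ne\emptyset$ then $S_1\cup S_2\in B$. The nestohedron of $B$ is the Minkowski sum $P_B=\sum_{S\in B}\Delta^S\subset\mathbb{R}^m$, where $\Delta^S=\operatorname{conv}\{e_i: i\in S\}$ and $e_1,\dots,e_m$ is the standard basis; it is a simple polytope. The permutohedron $Pe^n$ is the nestohedron of the building set of all nonempty subsets of $[n+1]$. A convex polytope is flag if any collection of pairwise intersecting facets has nonempty intersection. For a simple $n$-dimensional polytope $P$ let $f_i$ be the number of $i$-dimensional faces ($f_n=1$), and $h(P)(t)=\sum_{i=0}^n f_i(t-1)^i$. By the Dehn–Sommerville equations there are unique integers $\gamma_i=\gamma_i(P)$ with $h(P)(t)=\sum_{i=0}^{\lfloor n/2\rfloor}\gamma_i t^i(1+t)^{n-2i}$; the vector $(\gamma_0,\dots,\gamma_{\lfloor n/2\rfloor})$ is the $\gamma$-vector of $P$. *)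

(* Defs.v *)
From HB Require Import structures.
From mathcomp Require Export all_boot all_order all_algebra.
From mathcomp Require Export finmap.
From mathcomp Require Export boolp classical_sets cardinality reals.

Set Implicit Arguments.
Unset Strict Implicit.
Unset Printing Implicit Defensive.

Import Order.TTheory GRing.Theory Num.Theory.

Local Open Scope classical_set_scope.
Local Open Scope ring_scope.

(* The ground set [m] is 'I_m, i.e. {0, ..., m - 1}. *)
Definition building_set (m : nat) (B : {set {set 'I_m}}) : Prop :=
  [/\ (finset.set0 \notin B)%SET,
      (forall i : 'I_m, [set i]%SET \in B) &
      (forall S1 S2 : {set 'I_m}, S1 \in B -> S2 \in B ->
         (S1 :&: S2 != finset.set0)%SET -> (S1 :|: S2)%SET \in B)].

Definition full_building_set (m : nat) : {set {set 'I_m}} :=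
  [set S : {set 'I_m} | S != finset.set0]%SET.

Section Polytopes.
Context {R : realType} {m : nat}.
Implicit Types (P F : set 'rV[R]_m).

Definition conv_fam (I : finType) (S : {set I}) (p : I -> 'rV[R]_m)
    : set 'rV[R]_m :=
  [set x | exists w : I -> R,
     [/\ (forall i, i \in S -> 0 <= w i), \sum_(i in S) w i = 1 &
         x = \sum_(i in S) w i *: p i]].

Definition std_simplex (S : {set 'I_m}) : set 'rV[R]_m :=
  conv_fam S (fun i => delta_mx 0 i).

Definition minkowski_sum (I : finType) (B : {set I})
    (A : I -> set 'rV[R]_m) : set 'rV[R]_m :=
  [set x | exists y : I -> 'rV[R]_m,
     (forall i, i \in B -> A i (y i)) /\ x = \sum_(i in B) y i].

Definition affinely_independent (k : nat) (p : 'I_k.+1 -> 'rV[R]_m) : Prop :=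
  row_free (\matrix_(i < k) (p (lift ord0 i) - p ord0)).

(* Dimension of the affine hull: the largest k such that P contains k + 1
   affinely independent points. It is 0, not -1, on the empty set, so the
   definitions below ask for nonempty faces explicitly. *)
Definition affdim P : nat :=
  \max_(k < m.+1 | `[< exists p : 'I_k.+1 -> 'rV[R]_m,
                       affinely_independent p /\ forall i, P (p i) >]) k.

(* F is cut out of P by a valid linear inequality a . x <= b. Both P itself
   and the empty set are faces (take a = 0). *)
Definition face P F : Prop :=
  exists (a : 'rV[R]_m) (b : R),
    (forall x, P x -> \sum_i a 0 i * x 0 i <= b) /\
    F = P `&` [set x | \sum_i a 0 i * x 0 i = b].

Definition dfaces P (i : nat) : set (set 'rV[R]_m) :=
  [set F | [/\ face P F, F !=set0 & affdim F = i]].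

Definition facets P : set (set 'rV[R]_m) :=
  [set F | [/\ face P F, F !=set0 & (affdim F).+1 = affdim P]].

Definition flag P : Prop :=
  forall C : set (set 'rV[R]_m), C `<=` facets P ->
    (forall F G, C F -> C G -> F `&` G !=set0) ->
    \bigcap_(F in C) F !=set0.

(* fset_set of an infinite set is empty; a polytope has finitely many faces. *)
Definition fvec P (i : nat) : nat := #|` fset_set (dfaces P i)|%fset.

Definition hpoly P : {poly int} :=
  \sum_(i < (affdim P).+1) (fvec P i)%:R *: ('X - 1) ^+ i.

End Polytopes.

(* The expansion of h in the basis t^i (1 + t)^(n - 2i), i <= n/2; entries of g
   beyond n/2 are normalised to 0, which makes g unique. *)
Definition gamma_expansion (n : nat) (h : {poly int}) (g : nat -> int) : Prop :=
  h = \sum_(i < n./2.+1) g i *: ('X^i * (1 + 'X) ^+ (n - i.*2)) /\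
  forall i, (n./2 < i)%N -> g i = 0.

Lemma gamma_expansion_uniq (n : nat) (h : {poly int}) (g g' : nat -> int) :
  gamma_expansion n h g -> gamma_expansion n h g' -> g = g'.
Proof.
move=> [hg g0] [hg' g'0]; apply/funext => k.
have [kn|] := leqP k n./2; last by move=> nk; rewrite g0 ?g'0.
have c0 a : ((1 + 'X : {poly int}) ^+ a)`_0 = 1.
  by rewrite -horner_coef0 horner_exp !hornerE expr1n.
elim/ltn_ind: k kn => k IHk kn.
have cE (f : nat -> int) : (\sum_(i < n./2.+1)
      f i *: ('X^i * (1 + 'X) ^+ (n - i.*2)) : {poly int})`_k =
    f k + \sum_(i < n./2.+1 | (i < k)%N)
      f i * ((1 + 'X : {poly int}) ^+ (n - i.*2))`_(k - i).
  have kn' : (k < n./2.+1)%N by [].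
  rewrite coef_sum (bigID (fun i : 'I__ => (i < k)%N)) /= addrC.
  congr (_ + _); last first.
    by apply: eq_bigr => i ik; rewrite coefZ coefXnM ltnNge ltnW.
  rewrite (bigD1 (Ordinal kn')) /= ?ltnn// coefZ coefXnM ltnn subnn c0 mulr1.
  rewrite big1 ?addr0// => i /andP[]; rewrite -leqNgt => ki /eqP nki.
  rewrite coefZ coefXnM ltn_neqAle ki andbT.
  by case: eqP => [e|]; rewrite ?mulr0//; case: nki; apply: val_inj.
have := congr1 (fun p : {poly int} => p`_k) (etrans (esym hg) hg').
rewrite !cE => /eqP; rewrite (_ : \sum_(_ < _ | _) _ = \sum_(i < n./2.+1 | (i < k)%N)
      g' i * ((1 + 'X : {poly int}) ^+ (n - i.*2))`_(k - i)).
  by move=> /eqP/addIr.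
by apply: eq_bigr => i ik; rewrite IHk// (leq_trans (ltnW ik)).
Qed.

(* The default -1 (rather than 0) prevents a bound 0 <= gamma P i from holding
   merely because the expansion does not exist. *)
Definition gamma (R : realType) (m : nat) (P : set 'rV[R]_m) : nat -> int :=
  xget (fun=> -1) [set g | gamma_expansion (affdim P) (hpoly P) g].

Definition nestohedron (R : realType) (m : nat) (B : {set {set 'I_m}})
    : set 'rV[R]_m :=
  minkowski_sum B std_simplex.
Arguments nestohedron R {m} B.

Definition permutohedron (R : realType) (n : nat) : set 'rV[R]_n.+1 :=
  nestohedron R (full_building_set n.+1).
Arguments permutohedron R n : clear implicits.

(* Main.v *)
Require Import Defs.
From mathcomp Require Import ring zify.
From mathcomp Require Import fintype finset.

(** Write W for a set of vertices and B|W for the elements of B inside W; call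
    the maximal elements of B|W its components.

    A linear functional a selects on a nestohedron the face which is the
    Minkowski sum of the simplices on the sets where a is maximal on S, for S in
    B.  Let A be the union of these sets over the components C of B|W.  A set S
    of B|W that meets A contributes the simplex on S :&: A, while the sets that
    avoid A see the functional only on W :\: A.  So a face of P_(B|W) is a pair
    of a set A meeting every component and a face of P_(B|(W :\: A)), and its
    dimension exceeds that of the latter by |A| minus the number of components.
    Counting faces with weight (t - 1)^dim, this says that the h-polynomials of
    all restrictions of B satisfy a recursion that no longer mentions polytopes
    ([hnest], [sum_argmaps], [hpoly_nestohedron]).

    Three facts follow from the recursion by induction on W: h is multiplicative
    over components ([hnestM]); adding to B a set S that is the disjoint union
    of two elements S1, S2 of B changes h by t h(S1) h(S2) h(B/S), as shaving
    off the codimension 2 face P_(B|S1) x P_(B|S2) x P_(B/S) does ([hnest_add]);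
    and coning the disjoint union of two building sets multiplies h by 1 + t, so
    leaves the gamma-vector unchanged ([hnest_cone]).

    If P_B is flag, every element of B with at least two vertices splits into
    two disjoint elements of B ([flag_splittable]): otherwise a shortest
    partition of it into elements of B has three or more blocks, no union of two
    of which is in B, and the corresponding facets meet pairwise but not
    altogether.  Splitting is inherited by restrictions and contractions, and
    between two splittable building sets B1 and B2 containing B1 one can always
    add to B1 a set as in [hnest_add] without leaving B2 ([exists_add]).  Each
    addition increases the gamma-vector, by t times a product of gamma-vectors
    on fewer vertices ([gamma_mono]).  For a splittable B having W as an element
    and W = S1 :|: S2 a splitting, going up from the cone over B|S1 and B|S2 to
    B shows that gamma(B|W) >= 0; going further up to the full building set
    shows that gamma(B|W) is at most the gamma-vector of a permutohedron.

    A disconnected B yields a product, so the upper bound also needs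
    gamma(Pe^a) gamma(Pe^b) <= gamma(Pe^(a + b)).  This is immediate by
    induction from the recursion for gamma(Pe^n) ([gammaPeM]), which comes from
    the functional equation [hnest_fullU1] of the Eulerian polynomials. *)

Set Implicit Arguments.
Unset Strict Implicit.
Unset Printing Implicit Defensive.

Import Order.TTheory GRing.Theory Num.Theory.
Local Open Scope ring_scope.

(** * Components of a restriction and the recursion for h *)

Section Nest.
Variable m : nat.
Implicit Types (B K : {set {set 'I_m}}) (S T U W A C : {set 'I_m}).

(** These are the maximal elements of B inside W, described as the elements that
    absorb every element of B|W they meet: for a building set the two notions
    agree, and this one gives disjointness for free. *)
Definition comps B W : {set {set 'I_m}} :=
  [set C in B | (C \subset W) &&
    [forall S in B, (S \subset W) ==> (S :&: C != set0) ==> (S \subset C)]].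

Lemma compsP B W C : reflect
  [/\ C \in B, C \subset W &
      forall S, S \in B -> S \subset W -> S :&: C != set0 -> S \subset C]
  (C \in comps B W).
Proof.
rewrite inE; apply: (iffP and3P) => -[CB CW H]; split=> //.
  by move=> S SB SW SC; move/forall_inP/(_ S SB): H; rewrite SW SC.
by apply/forall_inP => S SB; apply/implyP => SW; apply/implyP; apply: H.
Qed.

Lemma meetI S T x : x \in S -> x \in T -> S :&: T != set0.
Proof. by move=> xS xT; apply/set0Pn; exists x; rewrite inE xS. Qed.

Lemma comps_cover B W x : building_set B -> x \in W ->
  exists2 C, C \in comps B W & x \in C.
Proof.
move=> [_ B1 BU] xW.
pose P S := [&& S \in B, S \subset W & x \in S].
have P0 : P [set x] by rewrite /P B1 sub1set xW set11.
case: (arg_maxnP (fun S : {set 'I_m} => #|S|) P0) => C /and3P[CB CW xC] Cmax.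
exists C => //; apply/compsP; split=> // S SB SW SC.
have: P (S :|: C) by rewrite /P BU// subUset SW CW inE xC orbT.
move/Cmax => /= le_card.
have /eqP -> : C == S :|: C by rewrite eqEcard subsetUr.
exact: subsetUl.
Qed.

Lemma comps_eq B W C D : C \in comps B W -> D \in comps B W ->
  C :&: D != set0 -> C = D.
Proof.
move=> /compsP[CB CW Cm] /compsP[DB DW Dm] CD.
by apply/eqP; rewrite eqEsubset Dm// Cm// setIC.
Qed.

Lemma comps_neq0 B W C : building_set B -> C \in comps B W -> C != set0.
Proof. by move=> [B0 _ _] /compsP[CB _ _]; apply: contraNneq B0 => <-. Qed.

Lemma comps_conn B W : building_set B -> W \in B -> comps B W = [set W].
Proof.
move=> hB WB; apply/setP => C; rewrite in_set1; apply/idP/eqP => [CW|->].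
  apply: (comps_eq CW).
    by apply/compsP; split=> // S SB SW _.
  have /set0Pn[x xC] := comps_neq0 hB CW.
  by apply: (@meetI _ _ x) => //; case/compsP: CW => _ /subsetP/(_ x xC).
by apply/compsP; split.
Qed.

Lemma comps0 B : building_set B -> comps B set0 = set0.
Proof.
move=> hB; apply/setP => C; rewrite in_set0; apply/negbTE/negP => CW.
by have := comps_neq0 hB CW; case/compsP: CW => _; rewrite subset0 => ->.
Qed.

Lemma comps_ext B B' W :
  (forall S, S \subset W -> (S \in B) = (S \in B')) -> comps B W = comps B' W.
Proof.
move=> E; apply/setP => C; apply/compsP/compsP => -[CB CW H]; split=> //.
- by rewrite -E.
- by move=> S SB SW; apply: H => //; rewrite E.
- by rewrite E.
- by move=> S SB SW; apply: H => //; rewrite -E.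
Qed.

(** The sets A for which some linear functional is maximal, over each component
    of B|W, exactly on the trace of A. *)
Definition hits B W A :=
  (A \subset W) && [forall C in comps B W, A :&: C != set0].

Lemma hitsP B W A : reflect
  (A \subset W /\ forall C, C \in comps B W -> A :&: C != set0) (hits B W A).
Proof.
by apply: (iffP andP) => -[AW H]; split=> //;
  [exact/forall_inP|apply/forall_inP].
Qed.

Lemma hits_neq0 B W A : building_set B -> W != set0 -> hits B W A -> A != set0.
Proof.
move=> hB /set0Pn[x xW] /hitsP[_ H].
have [C CW _] := comps_cover hB xW.
by apply: contraNneq (H _ CW) => ->; rewrite set0I.
Qed.

Lemma hits_card B W A : building_set B -> hits B W A ->
  (#|comps B W| <= #|A|)%N.
Proof.
move=> hB /hitsP[AW H].
(* Sending a vertex of A to its component reaches every component. *)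
pose f x := odflt set0 [pick C in comps B W | x \in C].
suff sub : comps B W \subset f @: A.
  exact: leq_trans (subset_leq_card sub) (leq_imset_card _ _).
apply/subsetP => C CW; have /set0Pn[x] := H _ CW; rewrite inE => /andP[xA xC].
apply/imsetP; exists x => //; rewrite /f;
  case: pickP => [D /andP[DW xD]|/(_ C)] /=.
  exact: (comps_eq CW DW (meetI xC xD)).
by rewrite CW xC.
Qed.

Lemma hits_conn B W A : building_set B -> W \in B ->
  hits B W A = (A \subset W) && (A != set0).
Proof.
move=> hB WB; rewrite /hits comps_conn//; have [AW|//] := boolP (A \subset W).
apply/forall_inP/idP => [/(_ W (set11 _))|A0 C]; first by rewrite (setIidPl AW).
by rewrite inE => /eqP ->; rewrite (setIidPl AW).
Qed.

(** The number [n] is fuel for a recursion on the size of W. *)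
Fixpoint hrec n B W : {poly int} :=
  if n is n'.+1 then
    \sum_(A | hits B W A)
      ('X - 1) ^+ (#|A| - #|comps B W|) * hrec n' B (W :\: A)
  else 1.

(** The h-polynomial of the nestohedron of B|W.  A polytope has h(t) = f(t - 1)
    for f the face polynomial, so every dimension counts as a power of t - 1. *)
Definition hnest B W := hrec #|W| B W.

Lemma hits0 B A : building_set B -> hits B set0 A = (A == set0).
Proof.
move=> hB; rewrite /hits subset0; case: eqP => //= _.
by apply/forall_inP => C; rewrite comps0// in_set0.
Qed.

Lemma hrec0 n B : building_set B -> hrec n B set0 = 1.
Proof.
move=> hB; elim: n => //= n IH.
rewrite (eq_bigl (pred1 set0)) ?big_pred1_eq => [|A]; last exact: hits0.
by rewrite set0D IH cards0 mulr1.
Qed.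

Lemma card_setD_lt W A : A \subset W -> A != set0 -> (#|W :\: A| < #|W|)%N.
Proof.
move=> AW /set0Pn[x xA]; apply/proper_card/properP; split;
  first exact: subsetDl.
by exists x; rewrite ?inE ?xA//; exact: (subsetP AW).
Qed.

Lemma hrecE n B W : building_set B -> (#|W| <= n)%N -> hrec n B W = hnest B W.
Proof.
move=> hB; rewrite /hnest.
have [k] := ubnP #|W|; elim: k n W => // k IH n W Wk Wn.
have [->|W0] := eqVneq W set0; first by rewrite !hrec0.
case: n Wn => [|n] Wn; first by rewrite leqn0 cards_eq0 (negPf W0) in Wn.
have [w Ew] : {w | #|W| = w.+1}.
  by exists #|W|.-1; rewrite prednK// card_gt0.
rewrite Ew /=; apply: eq_bigr => A hA.
have A0 := hits_neq0 hB W0 hA; have /hitsP[AW _] := hA.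
have lt : (#|W :\: A| < #|W|)%N := card_setD_lt AW A0.
have lw : (#|W :\: A| <= w)%N by rewrite -ltnS -Ew.
have lk : (#|W :\: A| < k)%N := leq_trans lt Wk.
by rewrite !IH// -ltnS (leq_trans lt).
Qed.

Lemma hnest0 B : building_set B -> hnest B set0 = 1.
Proof. exact: hrec0. Qed.

Lemma hnestE B W : building_set B ->
  hnest B W = \sum_(A | hits B W A)
    ('X - 1) ^+ (#|A| - #|comps B W|) * hnest B (W :\: A).
Proof.
move=> hB; rewrite -(@hrecE #|W|.+1) //=; apply: eq_bigr => A hA.
by rewrite hrecE//; apply/subset_leq_card/subsetDl.
Qed.

(** Thanks to this, restrictions never need to be formed: B|W is B seen through
    the subsets of W. *)
Lemma hnest_ext B B' W :
  (forall S, S \subset W -> (S \in B) = (S \in B')) -> hnest B W = hnest B' W.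
Proof.
rewrite /hnest; move: #|W| => n; elim: n W => //= n IH W E.
have Ec := comps_ext E.
apply: eq_big => [A|A _]; first by rewrite /hits Ec.
rewrite Ec IH// => S SW; apply: E; exact: subset_trans SW (subsetDl _ _).
Qed.

(** When W is itself in B the only condition on A is to be nonempty; the missing
    term A = set0 is (t - (t - 1)) h(W), which makes the sum complete. *)
Lemma hnest_conn B W : building_set B -> W \in B ->
  'X * hnest B W = \sum_(A : {set 'I_m} | A \subset W) ('X - 1) ^+ #|A| *
    hnest B (W :\: A).
Proof.
move=> hB WB; rewrite (bigD1 set0) ?sub0set//= cards0 mul1r setD0.
rewrite -[X in X * _](addrNK 1) addrC mulrDl mul1r; congr (_ + _).
rewrite hnestE// mulr_sumr; apply: eq_big => [A|A]; first exact: hits_conn.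
move=> hA; rewrite comps_conn// cards1 mulrA -exprS subn1 prednK//.
by move: hA; rewrite hits_conn// card_gt0 => /andP[].
Qed.

Lemma sum_subsetsU (V : nmodType) (W1 W2 : {set 'I_m}) (f : {set 'I_m} -> V) :
  W1 :&: W2 = set0 ->
  \sum_(A : {set 'I_m} | A \subset W1 :|: W2) f A =
  \sum_(A1 : {set 'I_m} | A1 \subset W1) \sum_(A2 : {set 'I_m} | A2 \subset W2)
    f (A1 :|: A2).
Proof.
move=> W12; rewrite pair_big /=.
rewrite (reindex_onto (fun p => p.1 :|: p.2) (fun A =>
  (A :&: W1, A :&: W2))) /=.
  apply: eq_bigl => -[A1 A2] /=; apply/andP/andP => [[sA /eqP[E1 E2]]|[s1 s2]].
    by rewrite -E1 -E2 !subsetIr.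
  split; first by rewrite setUSS.
  rewrite !setIUl (setIidPl s1) (setIidPl s2).
  have -> : A2 :&: W1 = set0.
    by apply/eqP; rewrite -subset0 -W12 setIC setIS.
  have -> : A1 :&: W2 = set0 by apply/eqP; rewrite -subset0 -W12 setSI.
  by rewrite setU0 set0U.
by move=> A sA; rewrite -setIUr (setIidPl sA).
Qed.

Lemma comps_split B W1 W2 : building_set B -> W1 :&: W2 = set0 ->
  (forall S, S \in B -> S \subset W1 :|: W2 ->
    (S \subset W1) || (S \subset W2)) ->
  comps B (W1 :|: W2) = comps B W1 :|: comps B W2
  /\ comps B W1 :&: comps B W2 = set0.
Proof.
move=> hB W12 H; split; last first.
  apply/eqP; rewrite -subset0; apply/subsetP => C;
    rewrite in_setI => /andP[C1 C2].
  have /set0Pn[x xC] := comps_neq0 hB C1.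
  case/compsP: C1 => _ /subsetP/(_ _ xC) x1 _.
  case/compsP: C2 => _ /subsetP/(_ _ xC) x2 _.
  by have := in_set0 x; rewrite -W12 inE x1 x2.
have sub D E : D :&: E = set0 -> (forall S, S \in B -> S \subset D :|: E ->
    (S \subset D) || (S \subset E)) ->
    comps B D \subset comps B (D :|: E).
  move=> DE0 h; apply/subsetP => C /compsP[CB CD Cm]; apply/compsP; split=> //.
    exact: subset_trans CD (subsetUl _ _).
  move=> S SB /(h _ SB)/orP[SD|SE] SC; first exact: Cm.
  case/set0Pn: SC => x; rewrite inE => /andP[/(subsetP SE) xE /(subsetP CD) xD].
  by have := in_set0 x; rewrite -DE0 inE xE xD.
apply/eqP; rewrite eqEsubset subUset sub//= andbC.
rewrite setUC sub; last 2 first.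
- by rewrite setIC.
- by move=> S SB; rewrite setUC orbC; exact: H.
rewrite /= setUC; apply/subsetP => C /compsP[CB CW Cm]; rewrite in_setU.
case/orP: (H _ CB CW) => CD; apply/orP; [left|right]; apply/compsP; split=> //.
  by move=> S SB SD; apply: Cm => //; exact: subset_trans SD (subsetUl _ _).
by move=> S SB SD; apply: Cm => //; exact: subset_trans SD (subsetUr _ _).
Qed.

Lemma hits_split B W1 W2 A1 A2 : building_set B -> W1 :&: W2 = set0 ->
  (forall S, S \in B -> S \subset W1 :|: W2 ->
    (S \subset W1) || (S \subset W2)) ->
  A1 \subset W1 -> A2 \subset W2 ->
  hits B (W1 :|: W2) (A1 :|: A2) = hits B W1 A1 && hits B W2 A2.
Proof.
move=> hB W12 H s1 s2; have [Ec _] := comps_split hB W12 H.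
have d1 C : C \in comps B W1 -> (A1 :|: A2) :&: C = A1 :&: C.
  case/compsP=> _ CW _; rewrite setIUl (_ : A2 :&: C = set0) ?setU0//.
  by apply/eqP; rewrite -subset0 -W12 setIC setISS.
have d2 C : C \in comps B W2 -> (A1 :|: A2) :&: C = A2 :&: C.
  case/compsP=> _ CW _; rewrite setIUl (_ : A1 :&: C = set0) ?set0U//.
  by apply/eqP; rewrite -subset0 -W12 setISS.
apply/hitsP/andP => [[_ h]|[/hitsP[_ h1] /hitsP[_ h2]]].
  split; apply/hitsP; split=> // C CW.
    by rewrite -d1// h// Ec in_setU CW.
  by rewrite -d2// h// Ec in_setU CW orbT.
split; first by rewrite setUSS.
move=> C; rewrite Ec in_setU => /orP[CW|CW]; first by rewrite d1// h1.
by rewrite d2// h2.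
Qed.

Lemma setDUU W1 W2 A1 A2 : W1 :&: W2 = set0 -> A1 \subset W1 -> A2 \subset W2 ->
  (W1 :|: W2) :\: (A1 :|: A2) = (W1 :\: A1) :|: (W2 :\: A2).
Proof.
move=> W12 /subsetP s1 /subsetP s2; apply/setP => x; rewrite !inE.
have := in_set0 x; rewrite -W12 inE.
have := s1 x; have := s2 x.
case: (x \in A1); case: (x \in A2); case: (x \in W1); case: (x \in W2) => //=;
  move=> h1 h2; first [by have := h1 isT | by have := h2 isT].
Qed.

Lemma cardUdisj (I : finType) (S T : {set I}) : S :&: T = set0 ->
  #|S :|: T| = (#|S| + #|T|)%N.
Proof. by move=> ST; rewrite cardsU ST cards0 subn0. Qed.

Lemma disjSS S T U W : S :&: T = set0 -> U \subset S -> W \subset T ->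
  U :&: W = set0.
Proof. by move=> ST US WT; apply/eqP; rewrite -subset0 -ST setISS. Qed.

(** The nestohedron of a building set with two separate parts is a product: a
    set hits all components of the union iff its two traces do. *)
Lemma hnestM B W1 W2 : building_set B -> W1 :&: W2 = set0 ->
  (forall S, S \in B -> S \subset W1 :|: W2 ->
    (S \subset W1) || (S \subset W2)) ->
  hnest B (W1 :|: W2) = hnest B W1 * hnest B W2.
Proof.
move=> hB; have [n] := ubnP #|W1 :|: W2|.
elim: n W1 W2 => // n IH W1 W2 Wn W12 H.
have [W0|W0] := eqVneq (W1 :|: W2) set0.
  by move/eqP: (W0); rewrite setU_eq0 => /andP[/eqP-> /eqP->];
    rewrite set0U hnest0// mulr1.
have E W : hnest B W = \sum_(A : {set 'I_m} | A \subset W) if hits B W A then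
    ('X - 1) ^+ (#|A| - #|comps B W|) * hnest B (W :\: A) else 0.
  by rewrite hnestE// -big_mkcondr; apply: eq_bigl => A;
    rewrite /hits andbA andbb.
rewrite E (sum_subsetsU _ W12) (E W1) (E W2) big_distrlr /=.
apply: eq_bigr => A1 s1; apply: eq_bigr => A2 s2.
have h := hits_split hB W12 H s1 s2; rewrite h.
have [t1|_] := boolP (hits B W1 A1); last by rewrite mul0r.
have [t2|_] := boolP (hits B W2 A2); last by rewrite mulr0.
have t12 : hits B (W1 :|: W2) (A1 :|: A2) by rewrite h t1.
have [Ec Ec0] := comps_split hB W12 H.
rewrite setDUU// IH; last 3 first.
- rewrite -setDUU//.
  exact: leq_trans (card_setD_lt (setUSS s1 s2) (hits_neq0 hB W0 t12)) Wn.
- by apply: disjSS W12 _ _; exact: subsetDl.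
- move=> S SB SW; case/orP: (H _ SB (subset_trans SW (setUSS (subsetDl _ _)
  (subsetDl _ _)))) => SS; apply/orP; [left|right].
  + apply/subsetP => x xS; have := subsetP SW x xS;
    rewrite !inE => /orP[//|/andP[_ x2]].
    by have := in_set0 x; rewrite -W12 inE x2 (subsetP SS x xS).
  + apply/subsetP => x xS; have := subsetP SW x xS;
    rewrite !inE => /orP[/andP[_ x2]|//].
    by have := in_set0 x; rewrite -W12 inE x2 (subsetP SS x xS).
have := hits_card hB t1; have := hits_card hB t2 => c2 c1.
rewrite Ec (cardUdisj Ec0) (cardUdisj (disjSS W12 s1 s2)).
have -> : (#|A1| + #|A2| - (#|comps B W1| + #|comps B W2|) =
  (#|A1| - #|comps B W1|) + (#|A2| - #|comps B W2|))%N by lia.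
by rewrite exprD mulrACA.
Qed.

End Nest.

(** * Contraction, and the effect of adding one set *)

Section Contract.
Variable m : nat.
Implicit Types (B K : {set {set 'I_m}}) (S T U W A C : {set 'I_m}).

(** The singletons of S are put back so that the contraction is a building set
    on the same ground set; it is only used on subsets avoiding S, where they
    are invisible. *)
Definition contract B S : {set {set 'I_m}} :=
  [set T | (T != set0) && [exists U in B, T == U :\: S]] :|:
  [set [set x] | x in [set: 'I_m]].

Lemma contractP B S T : reflect
  ((T != set0 /\ exists2 U, U \in B & T = U :\: S) \/ exists x, T = [set x])
  (T \in contract B S).
Proof.
rewrite inE [T \in [set _ | _]]inE; apply: (iffP orP).
  case=> [/andP[T0 /exists_inP[U UB /eqP TU]]|/imsetP[x _ ->]]; last by right;
    exists x.
  by left; split=> //; exists U.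
case=> [[T0 [U UB TU]]|[x ->]]; last by right; apply/imsetP; exists x.
by left; rewrite T0; apply/exists_inP; exists U => //; apply/eqP.
Qed.

Lemma contract_building B S : building_set B -> building_set (contract B S).
Proof.
move=> [B0 B1 BU]; split.
- apply/contractP => -[[]|[x /esym/eqP]]; first by rewrite eqxx.
  by rewrite -cards_eq0 cards1.
- by move=> x; apply/contractP; right; exists x.
move=> T1 T2 /contractP T1K /contractP T2K; case/set0Pn=> x.
rewrite inE => /andP[x1 x2].
case: T1K x1 => [[T10 [U1 U1B E1]] x1|[y ->]]; last first.
  by rewrite inE => /eqP ?; subst y; rewrite (setUidPr _) ?sub1set//;
    exact/contractP.
case: T2K x2 => [[T20 [U2 U2B E2]] x2|[y ->]]; last first.
  rewrite inE => /eqP ?; subst y; rewrite (setUidPl _) ?sub1set//.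
  by apply/contractP; left; split=> //; exists U1.
apply/contractP; left; split; first by apply/set0Pn; exists x; rewrite inE x1.
exists (U1 :|: U2); last by rewrite E1 E2 setDUl.
apply: BU => //; apply: (@meetI _ _ _ x).
  by move: x1; rewrite E1 inE => /andP[].
by move: x2; rewrite E2 inE => /andP[].
Qed.

(** The combinatorial form of shaving off a face of codimension 2, namely the
    intersection of the facets of S1 and S2: the new facet is that of S. *)
Section Add.
Variables (B : {set {set 'I_m}}) (S S1 S2 : {set 'I_m}).
Hypotheses (hB : building_set B) (hB' : building_set (S |: B))
  (SB : S \notin B).
Hypotheses (S1B : S1 \in B) (S2B : S2 \in B) (S12 : S1 :&: S2 = set0).
Hypothesis (ES : S = S1 :|: S2).

Lemma unstraddled T : T \in B -> T \subset S ->
  (T \subset S1) || (T \subset S2).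
Proof.
move=> TB TS; have [B0 B1 BU] := hB.
have [T1|T1] := eqVneq (T :&: S1) set0.
  apply/orP; right; apply/subsetP => x xT; have := subsetP TS x xT.
  rewrite ES inE => /orP[x1|//].
  by have := in_set0 x; rewrite -T1 inE xT x1.
have [T2|T2] := eqVneq (T :&: S2) set0.
  apply/orP; left; apply/subsetP => x xT; have := subsetP TS x xT.
  rewrite ES inE => /orP[//|x2].
  by have := in_set0 x; rewrite -T2 inE xT x2.
case/negP: SB; suff <- : (T :|: S1) :|: S2 = S.
  apply: (BU) => //; first exact: BU.
  by apply: contra_neq T2 => E; apply/eqP; rewrite -subset0 -E setSI// subsetUl.
by rewrite -setUA -ES; apply/setUidPr.
Qed.

Lemma hnest_pair : hnest B S = hnest B S1 * hnest B S2.
Proof. by rewrite {1}ES hnestM// -ES; exact: unstraddled. Qed.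

(** The restriction to S of B with S added is a cone over the product of the
    restrictions to S1 and S2.  In both restrictions the sum of
    (t - 1)^|A| h(S :\: A) is known: over B it factors, and over the enlarged
    building set the terms are the same except for A = set0. *)
Lemma hnest_cone : hnest (S |: B) S = (1 + 'X) * (hnest B S1 * hnest B S2).
Proof.
have X1 : ('X - 1 : {poly int}) != 0 by rewrite -polyC1 polyXsubC_eq0.
apply: (mulfI X1); rewrite mulrDl mulN1r hnest_conn ?setU11//.
(* The complete sum for B; each factor is an instance of [hnest_conn]. *)
have tot : \sum_(A : {set 'I_m} | A \subset S) ('X - 1) ^+ #|A| *
  hnest B (S :\: A)
    = ('X * hnest B S1) * ('X * hnest B S2).
  rewrite !hnest_conn// big_distrlr /= {1}ES sum_subsetsU//.
  apply: eq_bigr => A1 s1; apply: eq_bigr => A2 s2.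
  rewrite ES setDUU// cardUdisj; last exact: disjSS S12 _ _.
  rewrite hnestM //; last 2 first.
  - by apply: disjSS S12 _ _; exact: subsetDl.
  - move=> T TB TS.
    have := unstraddled TB; rewrite ES =>
      /(_ (subset_trans TS (setUSS (subsetDl _ _) (subsetDl _ _)))).
    case/orP=> TSi; apply/orP; [left|right]; apply/subsetP => x xT;
      have := subsetP TS x xT; have := subsetP TSi x xT; have := in_set0 x;
      rewrite -S12 !inE; by case: (x \in S1); case: (x \in S2);
        case: (x \in A1); case: (x \in A2).
  by rewrite exprD mulrACA.
rewrite (bigD1 (set0 : {set 'I_m})) ?sub0set//= cards0 expr0 mul1r setD0.
rewrite addrAC subrr add0r.
have -> : \sum_(A : {set 'I_m} | (A \subset S) && (A != set0))
    ('X - 1) ^+ #|A| * hnest (S |: B) (S :\: A) =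
  \sum_(A : {set 'I_m} | A \subset S) ('X - 1) ^+ #|A| *
    hnest B (S :\: A) - hnest B S.
  rewrite [X in _ = X - _](bigD1 (set0 : {set 'I_m})) ?sub0set//= cards0 expr0
    mul1r setD0.
  rewrite addrAC subrr add0r; apply: eq_bigr => A /andP[AS A0].
  congr (_ * _); apply: hnest_ext => T TS; rewrite in_setU1.
  case: eqP => // E; case/negP: A0; rewrite -subset0; apply/subsetP => x xA.
  have := subsetP TS x; rewrite E (subsetP AS x xA) => /(_ isT).
  by rewrite inE xA.
by rewrite tot hnest_pair; ring.
Qed.

(** If the new set is not a component of W, then some element of B meets S
    without being inside it; its union with S is a bigger element of B, so the
    components of W do not notice S. *)
Lemma comps_add W : S \subset W -> S \notin comps (S |: B) W ->
  comps (S |: B) W = comps B W /\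
  forall C, C \in comps B W -> S :&: C != set0 -> S \subset C.
Proof.
move=> SW Sn.
have [T [TB TW TS nTS]] :
    exists T, [/\ T \in B, T \subset W, T :&: S != set0 & ~~ (T \subset S)].
  move: Sn; rewrite inE setU11 SW /= => /forall_inPn[T].
  rewrite in_setU1 !negb_imply => /predU1P[->|TB /and3P[]]; last by exists T.
  by rewrite subxx !andbF.
have TSB : T :|: S \in B.
  have [_ _ BU'] := hB'.
  have := BU' T S; rewrite !in_setU1 TB eqxx orbT =>
    /(_ isT isT TS) /predU1P[E|//].
  by rewrite -E subsetUl in nTS.
have key C : C \in comps B W -> S :&: C != set0 -> S \subset C.
  case/compsP=> _ _ Cm SC; apply: subset_trans (Cm _ TSB _ _).
  - exact: subsetUr.
  - by rewrite subUset TW.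
  - by apply: contra_neq SC => E; apply/eqP;
    rewrite -subset0 -E setSI// subsetUr.
split=> //; apply/setP => C; apply/idP/idP => [CW|CW].
  case/compsP: (CW) => CB CsW Cm; apply/compsP; split=> //.
    by move: CB; rewrite in_setU1 => /predU1P[E|//]; rewrite E in CW;
      rewrite CW in Sn.
  by move=> U UB; apply: Cm; rewrite in_setU1 UB orbT.
case/compsP: (CW) => CB CsW Cm; apply/compsP; split=> //.
  by rewrite in_setU1 CB orbT.
move=> U; rewrite in_setU1 => /predU1P[->|UB]; [by move=> _;
  exact: key|exact: Cm].
Qed.

Section CompsContract.
Variable W : {set 'I_m}.
Hypotheses (SW : S \subset W).
Hypothesis (key : forall C, C \in comps B W -> S :&: C != set0 -> S \subset C).

Lemma compsD_neq0 C : C \in comps B W -> C :\: S != set0.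
Proof.
move=> CW; apply/negP => /eqP/eqP; rewrite setD_eq0 => CS.
have SC : S :&: C != set0 by rewrite (setIidPr CS); exact: comps_neq0 CW.
have E : C = S by apply/eqP; rewrite eqEsubset CS key.
by case/compsP: CW => + _ _; rewrite E (negPf SB).
Qed.

Lemma comps_contract :
  comps (contract B S) (W :\: S) = [set C :\: S | C in comps B W].
Proof.
have sub C : C \in comps B W -> C :\: S \in comps (contract B S) (W :\: S).
  move=> CW; case/compsP: (CW) => CB CsW Cm; apply/compsP; split.
  - by apply/contractP; left; split; [exact: compsD_neq0|exists C].
  - exact: setSD.
  move=> T /contractP[[_ [U UB ->]] UW UC|[x ->] _]; last first.
    by case/set0Pn=> y; rewrite !inE sub1set !inE => /andP[/eqP ->].
  apply/setSD/Cm => //.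
    rewrite -(setID U S) subUset (subset_trans (subsetIr _ _) SW).
    exact: subset_trans UW (subsetDl _ _).
  by apply: contra_neq UC => E; apply/eqP;
    rewrite -subset0 -E setISS// subsetDl.
apply/setP => D; apply/idP/imsetP => [DW|[C CW ->]]; last exact: sub.
have /set0Pn[x xD] := comps_neq0 (contract_building S hB) DW.
have xWS : x \in W :\: S by case/compsP: DW => _ /subsetP/(_ _ xD).
move: xWS; rewrite inE => /andP[xS xW].
have [C CW xC] := comps_cover hB xW.
exists C => //; apply: (comps_eq DW (sub _ CW)).
by apply: (meetI xD); rewrite inE xS.
Qed.

Lemma card_comps_contract : #|comps (contract B S) (W :\: S)| = #|comps B W|.
Proof.
rewrite comps_contract card_in_imset// => C D CW DW E.
have /set0Pn[x xC] := compsD_neq0 CW; apply: (comps_eq CW DW).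
have := xC; rewrite E => xD; apply: (@meetI _ _ _ x).
  by move: xC; rewrite inE => /andP[].
by move: xD; rewrite inE => /andP[].
Qed.

(** The components of the contraction are the traces of those of B, and none of
    them vanishes.  So the sets hitting them are those that hit the components
    of B and avoid S. *)
Lemma hits_contract A :
  hits (contract B S) (W :\: S) A = hits B W A && (A :&: S == set0).
Proof.
rewrite /hits subsetD -setI_eq0 comps_contract andbAC.
have [AS|] := eqVneq (A :&: S) set0; rewrite ?andbF// !andbT; congr (_ && _).
have E C : A :&: (C :\: S) = A :&: C.
  by rewrite setDE setIA [A :&: C]setIC -setIA -setDE (setDidPl _)// -setI_eq0
    AS.
apply/forall_inP/forall_inP => [H C CW|H _ /imsetP[C CW ->]];
  last by rewrite E H.
by rewrite -E; apply/H/imset_f.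
Qed.
End CompsContract.

(** The shaving formula.  If S is a component of W, both sides factor and the
    claim is [hnest_cone].  Otherwise B and the enlarged building set have the
    same components; in the recursion the terms where A meets S agree, as S is
    gone from W :\: A, and those where A avoids S differ, by induction, by terms
    that assemble into the recursion of the contraction. *)
Lemma hnest_add W : S \subset W ->
  hnest (S |: B) W =
  hnest B W + 'X * (hnest B S1 * hnest B S2 * hnest (contract B S) (W :\: S)).
Proof.
have hK := contract_building S hB.
have S0 : S != set0.
  case: hB' => B0 _ _; apply: contraNneq B0 => <-; exact: setU11.
have extD W' : ~~ (S \subset W') -> hnest (S |: B) W' = hnest B W'.
  move=> SW'; apply: hnest_ext => T TW; rewrite in_setU1.
  by case: eqP => // E; rewrite E (negPf SW') in TW.
have [n] := ubnP #|W|; elim: n W => // n IH W Wn SW.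
have W0 : W != set0 by apply: contraNneq S0 => E; rewrite -subset0 -E.
have [SC|SC] := boolP (S \in comps (S |: B) W).
  have EW : W = S :|: (W :\: S) by rewrite -{1}(setID W S) (setIidPr SW).
  have d : S :&: (W :\: S) = set0 by rewrite setIDA setIC -setIDA setDv setI0.
  have spl U : U \in S |: B -> U \subset W ->
    (U \subset S) || (U \subset W :\: S).
    move=> UB UW; case/compsP: SC => _ _ H.
    have [E|US] := eqVneq (U :&: S) set0; last by rewrite H.
    by rewrite subsetD UW -setI_eq0 E eqxx orbT.
  have spl' U : U \in B -> U \subset W -> (U \subset S) || (U \subset W :\: S).
    by move=> UB; apply: spl; rewrite in_setU1 UB orbT.
  have EK : hnest (contract B S) (W :\: S) = hnest B (W :\: S).
    apply: hnest_ext => T TW;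
      apply/contractP/idP => [[[T0 [U UB E]]|[x ->]]|TB].
    - have UW : U \subset W.
        rewrite -(setID U S) subUset (subset_trans (subsetIr _ _) SW).
        rewrite -E; exact: subset_trans TW (subsetDl _ _).
      have /orP[US|UWS] := spl' _ UB UW.
        move: T0; rewrite E; have -> : U :\: S = set0 by apply/eqP;
          rewrite setD_eq0.
        by rewrite eqxx.
      suff -> : T = U by [].
      by rewrite E (setDidPl _)//; move: UWS; rewrite subsetD => /andP[].
    - by case: hB => _ B1 _; apply: B1.
    left; split; first by apply: contraTneq TB => ->; case: hB.
    by exists T => //; rewrite (setDidPl _)//; move: TW;
      rewrite subsetD => /andP[].
  have nS : ~~ (S \subset W :\: S).
    apply: contra S0 => SS; by rewrite -subset0 -d subsetI subxx.
  (* Both building sets split along the component S. *)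
  have M B' : building_set B' -> (forall U, U \in B' -> U \subset W ->
      (U \subset S) || (U \subset W :\: S)) ->
    hnest B' W = hnest B' S * hnest B' (W :\: S).
    by move=> hB'' H; rewrite {1}EW hnestM// -EW.
  rewrite EK !M//.
  by rewrite (extD _ nS) hnest_cone hnest_pair; ring.
have [Ec key] := comps_add SW SC.
rewrite (hnestE W hB') (hnestE W hB) (hnestE (W :\: S) hK) Ec.
have Eh A : hits (S |: B) W A = hits B W A by rewrite /hits Ec.
rewrite (eq_bigl _ _ Eh) (bigID (fun A => A :&: S == set0)) /=.
rewrite [X in _ = X + _](bigID (fun A => A :&: S == set0)) /=.
rewrite addrAC; congr (_ + _); last first.
  apply: eq_bigr => A /andP[hA AS]; rewrite extD//.
  apply: contra AS => SWA; rewrite -subset0; apply/subsetP => x.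
  by rewrite inE => /andP[xA /(subsetP SWA)]; rewrite inE xA.
rewrite mulr_sumr mulr_sumr (eq_bigl _ _ (hits_contract SW key)) -big_split /=.
apply: eq_bigr => A /andP[hA AS]; rewrite card_comps_contract//.
have A0 := hits_neq0 hB W0 hA; have /hitsP[AW _] := hA.
rewrite IH.
- rewrite setDDl [A :|: S]setUC -setDDl mulrDr mulrCA.
  by congr (_ + _ * _); rewrite mulrCA.
- exact: leq_trans (card_setD_lt AW A0) Wn.
by rewrite subsetD SW -setI_eq0 setIC.
Qed.
End Add.
End Contract.

(** * Splittable building sets *)

Section Splittable.
Variable m : nat.
Implicit Types (B K : {set {set 'I_m}}) (S T U W A C : {set 'I_m}).

(** This is how flagness of the nestohedron shows in the building set, see
    [flag_splittable]; unlike flagness it is visibly inherited by restrictions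
    and contractions. *)
Definition splittable B := forall S, S \in B -> (1 < #|S|)%N ->
  exists S1 S2, [/\ S1 \in B, S2 \in B, S1 :&: S2 = set0 & S = S1 :|: S2].

(** A splitting of U induces one of U :\: S, unless one of its halves lies in S;
    then the other half has the same trace as U and fewer vertices. *)
Lemma contract_splittable B S : building_set B -> splittable B ->
  splittable (contract B S).
Proof.
move=> hB sB T /contractP[[_ [U UB ->]]|[x ->]]; last by rewrite cards1.
have [n] := ubnP #|U|; elim: n U UB => // n IH U UB Un T1.
have [|U1 [U2 [U1B U2B U12 EU]]] := sB U UB.
  exact: leq_trans T1 (subset_leq_card (subsetDl _ _)).
have [B0 _ _] := hB.
have pos V : V \in B -> (0 < #|V|)%N.
  by move=> VB; rewrite card_gt0; apply: contraNneq B0 => <-.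
have cU : #|U| = (#|U1| + #|U2|)%N by rewrite EU cardUdisj.
have ED : U :\: S = (U1 :\: S) :|: (U2 :\: S) by rewrite EU setDUl.
have [E1|N1] := eqVneq (U1 :\: S) set0.
  rewrite ED E1 set0U; apply: IH => //; last by rewrite -[_ :\: _]set0U -E1 -ED.
  by apply: (leq_trans _ (Un : (#|U| <= n)%N));
    rewrite cU -[ltnLHS]add0n ltn_add2r pos.
have [E2|N2] := eqVneq (U2 :\: S) set0.
  rewrite ED E2 setU0; apply: IH => //; last by rewrite -[_ :\: _]setU0 -E2 -ED.
  by apply: (leq_trans _ (Un : (#|U| <= n)%N));
    rewrite cU -[ltnLHS]addn0 ltn_add2l pos.
exists (U1 :\: S), (U2 :\: S); split=> //.
- by apply/contractP; left; split=> //; exists U1.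
- by apply/contractP; left; split=> //; exists U2.
by apply: disjSS U12 _ _; exact: subsetDl.
Qed.

Lemma splittableU1 B U U1 U2 : splittable B -> U1 \in B -> U2 \in B ->
  U1 :&: U2 = set0 -> U = U1 :|: U2 -> splittable (U |: B).
Proof.
move=> sB U1B U2B U12 EU S; rewrite in_setU1 => /predU1P[->|SB] S1.
  by exists U1, U2; split=> //; rewrite in_setU1 ?U1B ?U2B orbT.
have [S' [S'' [SB' SB'' d E]]] := sB S SB S1.
by exists S', S''; split=> //; rewrite in_setU1 ?SB' ?SB'' orbT.
Qed.

(** A minimal element of B2 missing from B1 splits in B2 into smaller pieces,
    which are thus in B1: so B2 :\: B1 contains unions of two disjoint elements
    of B1.  Among these, one of maximal size can be added: joining to it a set
    that meets one of its halves enlarges that half inside B1, and the result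
    is again such a union, so it is in B1 or not larger. *)
Lemma exists_add B1 B2 : building_set B1 -> building_set B2 -> splittable B2 ->
  B1 \proper B2 ->
  exists U1 U2, [/\ U1 \in B1, U2 \in B1, U1 :&: U2 = set0,
    U1 :|: U2 \in B2 :\: B1 & building_set ((U1 :|: U2) |: B1)].
Proof.
move=> [B10 B11 B1U] [B20 B21 B2U] sB2 /properP[sub [S0 S0B2 S0B1]].
pose P p := [&& p.1 \in B1, p.2 \in B1, p.1 :&: p.2 == set0
              & p.1 :|: p.2 \in B2 :\: B1].
have [[V1 V2] PV] : exists p, P p.
  pose Q S := S \in B2 :\: B1.
  have PS0 : Q S0 by rewrite /Q inE S0B1.
  case: (arg_minnP (fun S : {set 'I_m} => #|S|) PS0) => S.
  rewrite {1}/Q inE => /andP[SB1 SB2] Smin.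
  have [|S1 [S2 [S1B S2B S12 ES]]] := sB2 S SB2.
    rewrite ltnNge; apply: contra SB1 => S1; have : #|S| == 1%N.
      by rewrite eqn_leq S1 card_gt0; apply: contraNneq B20 => <-.
    by case/cards1P=> x ->.
  have cS : #|S| = (#|S1| + #|S2|)%N by rewrite ES cardUdisj.
  have pos V : V \in B2 -> (0 < #|V|)%N.
    by move=> VB; rewrite card_gt0; apply: contraNneq B20 => <-.
  have inB1 V : V \in B2 -> (#|V| < #|S|)%N -> V \in B1.
    move=> VB; apply: contraTT => VB1; rewrite -leqNgt; apply: Smin.
    by rewrite /Q inE VB1.
  exists (S1, S2); apply/and4P; rewrite /= -ES; split.
  - by apply: inB1 => //; rewrite cS -[ltnLHS]addn0 ltn_add2l pos.
  - by apply: inB1 => //; rewrite cS -[ltnLHS]add0n ltn_add2r pos.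
  - exact/eqP.
  - by rewrite inE SB1.
case: (arg_maxnP (fun p : {set 'I_m} * {set 'I_m} => #|p.1 :|: p.2|) PV).
move=> [U1 U2] /and4P[/= U1B U2B /eqP U12 UB] Umax.
have [UB1 UB2] : U1 :|: U2 \notin B1 /\ U1 :|: U2 \in B2.
  by move: UB; rewrite inE => /andP[].
exists U1, U2; split=> //.
have grow V1' V2' T : V1' \in B1 -> V2' \in B1 -> V1' :|: V2' = U1 :|: U2 ->
    V1' :&: V2' = set0 -> T \in B1 -> T :&: V1' != set0 ->
    T :|: (U1 :|: U2) \in (U1 :|: U2) |: B1.
  move=> V1B V2B EV V12 TB TV1; rewrite -EV setUA.
  have TV : T :|: V1' \in B1 by exact: B1U.
  have [T2|T2] := eqVneq ((T :|: V1') :&: V2') set0; last first.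
    by rewrite in_setU1 (B1U _ _ TV V2B T2) orbT.
  rewrite in_setU1; have [//|nB1] := boolP (_ \in B1); first by rewrite orbT.
  (* T and V2' are disjoint: if their union is not in B1, maximality applies. *)
  have sV : V1' :|: V2' \subset T :|: V1' :|: V2' by rewrite setSU// subsetUr.
  rewrite orbF eq_sym eqEcard sV /= EV (Umax (T :|: V1', V2'))//.
  rewrite /P /= TV V2B T2 eqxx /= inE nB1 /= -setUA EV.
  apply: B2U => //; first exact: (subsetP sub).
  by rewrite -EV; apply: contra_neq TV1 => E; apply/eqP;
    rewrite -subset0 -E setIS// subsetUl.
have add T : T \in B1 -> T :&: (U1 :|: U2) != set0 ->
    T :|: (U1 :|: U2) \in (U1 :|: U2) |: B1.
  move=> TB; rewrite setIUr; have [T1|T1 _] := eqVneq (T :&: U1) set0.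
    by rewrite T1 set0U; apply: (grow U2 U1);
      rewrite // 1?[U2 :|: _]setUC 1?[U2 :&: _]setIC.
  exact: (grow U1 U2).
split.
- rewrite in_setU1 negb_or B10 andbT.
  by apply: contraNneq B20 => ->.
- by move=> x; rewrite in_setU1 B11 orbT.
move=> S T; rewrite !in_setU1 => /predU1P[->|SB] /predU1P[->|TB] ST.
- by rewrite setUid eqxx.
- by rewrite -in_setU1 setUC add// setIC.
- by rewrite -in_setU1 add.
- by rewrite (B1U _ _ SB TB ST) orbT.
Qed.
End Splittable.

(** * The calculus of gamma-vectors, and those of permutohedra *)

Section GammaCalculus.
Implicit Types (p q r g h : {poly int}) (n k : nat).

Definition coef_le p q := forall i, p`_i <= q`_i.

Lemma coef_le_refl p : coef_le p p. Proof. by move=> i. Qed.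

Lemma coef_le_trans q p r : coef_le p q -> coef_le q r -> coef_le p r.
Proof. by move=> pq qr i; exact: le_trans (pq i) (qr i). Qed.

Lemma coef_leD p q p' q' :
  coef_le p q -> coef_le p' q' -> coef_le (p + p') (q + q').
Proof. by move=> H H' i; rewrite !coefD lerD. Qed.

Lemma coef_leMl r p q : coef_le 0 r -> coef_le p q -> coef_le (r * p) (r * q).
Proof.
move=> r0 pq i; rewrite !coefM; apply: ler_sum => j _.
by rewrite ler_wpM2l//; have := r0 j; rewrite coef0.
Qed.

Lemma coef_leMr r p q : coef_le 0 r -> coef_le p q -> coef_le (p * r) (q * r).
Proof. by move=> r0 pq; rewrite ![_ * r]mulrC; exact: coef_leMl. Qed.

Lemma coef_leM p q : coef_le 0 p -> coef_le 0 q -> coef_le 0 (p * q).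
Proof. by move=> p0 q0; rewrite -(mulr0 p); exact: coef_leMl. Qed.

Lemma coef_leX : coef_le 0 'X.
Proof. by move=> i; rewrite coef0 coefX; case: eqP. Qed.

Lemma coef_le1 : coef_le 0 1.
Proof. by move=> i; rewrite coef0 coef1; case: eqP. Qed.

Lemma coef_leMn p q a : coef_le p q -> coef_le (p *+ a) (q *+ a).
Proof. by move=> pq i; rewrite !coefMn lerMn2r pq orbT. Qed.

Lemma coef_leMnr p a b : coef_le 0 p -> (a <= b)%N -> coef_le (p *+ a) (p *+ b).
Proof.
move=> p0 ab i; rewrite !coefMn; apply: ler_wpMn2l => //.
by have := p0 i; rewrite coef0.
Qed.

Lemma coef_le_sum (I : Type) (s : seq I) (P : pred I) (F G : I -> {poly int}) :
  (forall i, P i -> coef_le (F i) (G i)) ->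
  coef_le (\sum_(i <- s | P i) F i) (\sum_(i <- s | P i) G i).
Proof.
move=> H; elim/big_rec2: _ => [|i p q Pi]; first exact: coef_le_refl.
by move=> pq; apply: coef_leD => //; exact: H.
Qed.

Lemma coef_le_sum0 (I : Type) (s : seq I) (P : pred I) (F : I -> {poly int}) :
  (forall i, P i -> coef_le 0 (F i)) -> coef_le 0 (\sum_(i <- s | P i) F i).
Proof.
move=> H; have {1}<- : \sum_(i <- s | P i) 0 = 0 :> {poly int} by exact: big1.
exact: coef_le_sum.
Qed.

(** The gamma-vector is carried by a polynomial, so that a product of polytopes
    corresponds to a product of gamma-polynomials. *)
Definition gam_poly n g : {poly int} :=
  \sum_(i < n./2.+1) g`_i *: ('X^i * (1 + 'X) ^+ (n - i.*2)).

Definition has_gamma n g h := (size g <= n./2.+1)%N /\ h = gam_poly n g.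

Lemma has_gamma_expansion n g h : has_gamma n g h ->
  gamma_expansion n h (fun i => g`_i).
Proof. by move=> [sg ->]; split=> // i ni; apply: nth_default;
  apply: leq_trans sg _. Qed.

Lemma has_gamma_uniq n g g' h : has_gamma n g h -> has_gamma n g' h -> g = g'.
Proof.
move=> H H'; apply/polyP => i.
have := gamma_expansion_uniq (has_gamma_expansion H) (has_gamma_expansion H').
by move/(congr1 (fun f => f i)).
Qed.

Lemma has_gammaD n g g' h h' : has_gamma n g h -> has_gamma n g' h' ->
  has_gamma n (g + g') (h + h').
Proof.
move=> [s ->] [s' ->]; split.
  by apply: leq_trans (size_polyD _ _) _; rewrite geq_max s s'.
by rewrite -big_split; apply: eq_bigr => i _; rewrite coefD scalerDl.
Qed.

Lemma has_gamma_sum n (I : Type) (s : seq I) (P : pred I) (G H : I ->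
  {poly int}) :
  (forall i, P i -> has_gamma n (G i) (H i)) ->
  has_gamma n (\sum_(i <- s | P i) G i) (\sum_(i <- s | P i) H i).
Proof.
move=> GH; elim/big_rec2: _ => [|i h g Pi gh];
  last exact: has_gammaD (GH _ Pi) _.
split; first by rewrite size_poly0.
by rewrite /gam_poly big1// => i _; rewrite coef0 scale0r.
Qed.

Lemma expf_sub (F : fieldType) (z : F) n k : z != 0 -> (k <= n)%N ->
  z ^+ (n - k) = z ^+ n / z ^+ k.
Proof. by move=> z0 kn; rewrite -{2}(subnK kn) exprD mulfK// expf_neq0. Qed.

Local Notation tof := (@tofrac {poly int}).
Local Notation Y := (tof 'X / tof (1 + 'X) ^+ 2).

(** The point of passing to fractions: h = (1 + t)^n g(t / (1 + t)^2), and from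
    this form multiplicativity is evident. *)
Lemma gam_poly_frac n g : (size g <= n./2.+1)%N ->
  tof (gam_poly n g) = tof (1 + 'X) ^+ n * (map_poly intr g).[Y].
Proof.
move=> sg; have nz : tof (1 + 'X) != 0.
  by rewrite tofrac_eq0 addrC -[1]opprK -polyC1 -polyCN polyXsubC_eq0.
rewrite (@horner_coef_wide _ n./2.+1); last exact: leq_trans (size_poly _ _) sg.
rewrite mulr_sumr rmorph_sum; apply: eq_bigr => i _.
rewrite -mul_polyC !rmorphM !rmorphXn /= coef_map /= expr_div_n [RHS]mulrCA.
congr (_ * _); first by rewrite -[in LHS](intz g`_i) !rmorph_int.
rewrite [RHS]mulrCA; congr (_ * _); rewrite -exprM mul2n.
have i2 : (i.*2 <= n)%N.
  by have := ltn_ord i; rewrite ltnS -leq_double => /leq_trans; apply; lia.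
exact: expf_sub.
Qed.

Lemma has_gammaM n n' g g' h h' : has_gamma n g h -> has_gamma n' g' h' ->
  has_gamma (n + n') (g * g') (h * h').
Proof.
move=> [s ->] [s' ->].
have S : (size (g * g')%R <= (n + n')./2.+1)%N.
  apply: leq_trans (size_polyMleq _ _) _; lia.
split=> //; apply/eqP; rewrite -tofrac_eq rmorphM /= !gam_poly_frac//.
by rewrite rmorphM /= hornerM exprD mulrACA.
Qed.

Lemma has_gamma0 : has_gamma 0 1 1.
Proof.
split; first by rewrite size_poly1.
by rewrite /gam_poly big_ord1 coef1 scale1r mul1r.
Qed.

Lemma has_gamma1 : has_gamma 1 1 (1 + 'X).
Proof.
split; first by rewrite size_poly1.
by rewrite /gam_poly big_ord1 coef1 scale1r mul1r.
Qed.

Lemma has_gamma2 : has_gamma 2 'X 'X.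
Proof.
split; first by rewrite size_polyX.
by rewrite /gam_poly big_ord_recl big_ord1 !coefX scale0r scale1r add0r mulr1.
Qed.

Lemma has_gammaX n g h : has_gamma n g h -> has_gamma n.+2 ('X * g) ('X * h).
Proof. exact: has_gammaM has_gamma2. Qed.

Lemma has_gammaX1 n g h : has_gamma n g h -> has_gamma n.+1 g ((1 + 'X) * h).
Proof. by move/(has_gammaM has_gamma1); rewrite mul1r. Qed.

End GammaCalculus.

Section GammaPe.

(** The gamma-polynomials of permutohedra, by the recursion which comes from
    building the permutohedron on k + 1 vertices out of the cone over the one on
    k vertices; [f] is fuel. *)
Fixpoint gammaPe_rec f k : {poly int} :=
  if f is f'.+1 then if k is k'.+1 then
    gammaPe_rec f' k' + 'X * \sum_(i < k')
      (gammaPe_rec f' i * gammaPe_rec f' (k'.-1 - i)%N) *+ 'C(k, i.+1)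
  else 1 else 1.

Definition gammaPe k := gammaPe_rec k k.

Lemma gammaPe_recE f k : (k <= f)%N -> gammaPe_rec f k = gammaPe k.
Proof.
rewrite /gammaPe; have [n] := ubnP k;
  elim: n f k => // n IH [|f] [|k] //= kn kf.
have E j : (j <= k)%N -> gammaPe_rec f j = gammaPe_rec k j.
  by move=> jk; rewrite IH ?[in RHS]IH//; lia.
rewrite E//; congr (_ + _ * _); apply: eq_bigr => i _.
by have ik := ltn_ord i; rewrite !E//; lia.
Qed.

Lemma gammaPe0 : gammaPe 0 = 1. Proof. by []. Qed.

Lemma gammaPeS k : gammaPe k.+1 = gammaPe k +
  'X * \sum_(i < k) (gammaPe i * gammaPe (k.-1 - i)%N) *+ 'C(k.+1, i.+1).
Proof.
rewrite {1}/gammaPe /=; congr (_ + _ * _); apply: eq_bigr => i _.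
by have ik := ltn_ord i; rewrite !gammaPe_recE//; lia.
Qed.

Lemma gammaPe_ge0 k : coef_le 0 (gammaPe k).
Proof.
have [n] := ubnP k; elim: n k => // n IH [|k] kn; first exact: coef_le1.
rewrite gammaPeS -[X in coef_le X _]addr0; apply: coef_leD; first exact: IH.
apply: coef_leM; first exact: coef_leX.
apply: coef_le_sum0 => i _; have ik := ltn_ord i.
rewrite -(mul0rn _ 'C(k.+1, i.+1)); apply/coef_leMn/coef_leM; apply: IH; lia.
Qed.

(** Multiply the recursion for a by gamma(Pe^b) and apply the induction
    hypothesis to every product: the result is part of the recursion for a + b,
    with smaller binomial coefficients. *)
Lemma gammaPeM a b : coef_le (gammaPe a * gammaPe b) (gammaPe (a + b)).
Proof.
have [n] := ubnP a; elim: n a => // n IH [|a] an.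
  by rewrite gammaPe0 mul1r; exact: coef_le_refl.
rewrite gammaPeS mulrDl addSn gammaPeS; apply: coef_leD; first exact: IH.
rewrite -mulrA; apply: coef_leMl; first exact: coef_leX.
rewrite mulr_suml.
rewrite -[X in coef_le _ X](big_mkord xpredT (fun i =>
  (gammaPe i * gammaPe ((a + b).-1 - i)%N) *+ 'C((a + b).+1, i.+1))).
rewrite -(big_mkord xpredT (fun i =>
  (gammaPe i * gammaPe (a.-1 - i)%N) *+ 'C(a.+1, i.+1) * gammaPe b)).
rewrite (big_cat_nat (leq0n a) (leq_addr b a)) /= -[X in coef_le X _]addr0.
apply: coef_leD; last first.
  apply: coef_le_sum0 => i _; rewrite -(mul0rn _ 'C((a + b).+1, i.+1)).
  by apply/coef_leMn/coef_leM; exact: gammaPe_ge0.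
rewrite big_nat [X in coef_le _ X]big_nat; apply: coef_le_sum => i /andP[_ ia].
rewrite mulrnAl -mulrA.
have le1 : coef_le (gammaPe i * (gammaPe (a.-1 - i)%N * gammaPe b))
    (gammaPe i * gammaPe ((a + b).-1 - i)%N).
  apply: coef_leMl; first exact: gammaPe_ge0.
  have -> : ((a + b).-1 - i = a.-1 - i + b)%N by lia.
  by apply: IH; lia.
apply: coef_le_trans (coef_leMn _ le1) _; apply: coef_leMnr.
  by apply: coef_leM; exact: gammaPe_ge0.
by apply: leq_bin2l; lia.
Qed.

End GammaPe.

(** * The full building set *)

Section FullBuildingSet.
Variable m : nat.
Implicit Types (S T U W A C J : {set 'I_m}).
Local Notation full := (full_building_set m).

Lemma full_building : building_set full.
Proof.
split; first by rewrite inE eqxx.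
  by move=> x; rewrite inE -cards_eq0 cards1.
move=> S T; rewrite !inE => S0 T0 _.
by apply: contra_neq S0 => E; apply/eqP; rewrite -subset0 -E subsetUl.
Qed.

Lemma full_splittable : splittable full.
Proof.
move=> S _ S1; have /set0Pn[x xS] : S != set0 by rewrite -card_gt0; lia.
exists [set x], (S :\ x); split.
- by rewrite inE -cards_eq0 cards1.
- by rewrite inE -card_gt0; move: (cardsD1 x S); rewrite xS; lia.
- by rewrite setIDA; apply/eqP; rewrite setD_eq0 subsetIl.
by rewrite setD1K.
Qed.

Lemma building_sub_full B : building_set B -> B \subset full.
Proof.
move=> [B0 _ _]; apply/subsetP => S SB; rewrite inE.
by apply: contraNneq B0 => <-.
Qed.

Local Notation F := (hnest full).

(** This is the recursion of h over the full building set, with a correction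
    that makes it hold for the empty set too. *)
Lemma full_conv W :
  \sum_(A : {set 'I_m} | A \subset W) ('X - 1) ^+ #|A| * F (W :\: A) =
  'X * F W - ('X - 1) *+ (W == set0).
Proof.
have [->|W0] := eqVneq W set0.
  rewrite (eq_bigl (pred1 set0)) => [|A]; last by rewrite subset0.
  rewrite big_pred1_eq cards0 set0D hnest0 ?mulr1; last exact: full_building.
  by rewrite opprB addrCA subrr addr0.
by rewrite subr0 hnest_conn//; [exact: full_building|rewrite inE].
Qed.

(** Eulerian polynomials satisfy E' = t E^2 - (t - 1) E for their exponential
    generating function E.  Here this is obtained from the recursion alone:
    splitting the sum for x |: W according to whether A contains x, the terms
    with x are a sum over W, and the terms without x are given by induction,
    except for A = set0; then a factor t - 1 is cancelled. *)
Lemma hnest_fullU1 W x : x \notin W ->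
  F (x |: W) = 'X * (\sum_(J : {set 'I_m} | J \subset W) F J * F (W :\: J))
               - ('X - 1) * F W.
Proof.
have [n] := ubnP #|W|; elim: n W => // n IH W Wn xW.
pose conv (V : {set 'I_m}) : {poly int} :=
  \sum_(J : {set 'I_m} | J \subset V) F J * F (V :\: J).
pose M (V : {set 'I_m}) : {poly int} :=
  \sum_(A : {set 'I_m} | A \subset V) ('X - 1) ^+ #|A| * F (V :\: A).
have X1 : ('X - 1 : {poly int}) != 0 by rewrite -polyC1 polyXsubC_eq0.
have xUW : x |: W \in full.
  by rewrite inE; apply/set0Pn; exists x; rewrite setU11.
have E1 : 'X * F (x |: W) =
    \sum_(A : {set 'I_m} | A \subset W) ('X - 1) ^+ #|A| * F (x |: (W :\: A)) +
    ('X - 1) * M W.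
  rewrite hnest_conn//; last exact: full_building.
  have d : [set x] :&: W = set0.
    by apply/setP => y; rewrite !inE; case: eqP => // ->; rewrite (negPf xW).
  rewrite (sum_subsetsU _ d) (bigD1 [set x]) //= [X in _ + X](bigD1 set0) /=;
    last first.
    by rewrite sub0set eq_sym -cards_eq0 cards1.
  rewrite [X in _ + (_ + X)]big1 ?addr0 => [|A /andP[/andP[Ax An] A0]];
    last first.
    by move: Ax; rewrite subset1 (negPf An) (negPf A0).
  rewrite addrC; congr (_ + _).
    apply: eq_bigr => A AW; rewrite set0U; congr (_ * F _).
    apply/setP => y; rewrite !inE; case: eqP => // ->.
    by rewrite (negPf (contra (subsetP AW x) xW)).
  rewrite mulr_sumr; apply: eq_bigr => A AW.
  have xA : x \notin A := contra (subsetP AW x) xW.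
  rewrite cardsU1 xA exprS mulrA; congr (_ * F _).
  apply/setP => y; rewrite !inE; case: eqP => // ->.
  by rewrite (negPf xW) andbF.
(* Exchange A and J: the inner sum over A is then the one in [full_conv]. *)
have swap : \sum_(A : {set 'I_m} | A \subset W) ('X - 1) ^+ #|A| *
  conv (W :\: A) =
    'X * conv W - ('X - 1) * F W.
  rewrite /conv; under eq_bigr do rewrite mulr_sumr.
  rewrite (exchange_big_dep (fun J => J \subset W)) /=; last first.
    by move=> A J _ /subset_trans; apply; exact: subsetDl.
  have E J : J \subset W ->
    \sum_(A : {set 'I_m} | (A \subset W) && (J \subset W :\: A))
      ('X - 1) ^+ #|A| * (F J * F (W :\: A :\: J)) =
      'X * (F J * F (W :\: J)) - ('X - 1) * F J *+ (W == J).
    move=> JW; have -> : (W == J) = (W :\: J == set0).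
      by rewrite setD_eq0 eqEsubset JW andbT.
    have -> : 'X * (F J * F (W :\: J)) - ('X - 1) * F J *+ (W :\: J == set0) =
        F J * M (W :\: J).
      by rewrite /M full_conv mulrBr mulrnAr mulrCA [('X - 1) * F J]mulrC.
    rewrite mulr_sumr; apply: eq_big => A.
      rewrite !subsetD JW /= disjoint_sym; by case: (A \subset W).
    by move=> _; rewrite mulrCA setDDl setUC -setDDl.
  rewrite (eq_bigr _ E) sumrB -mulr_sumr; congr (_ - _).
  rewrite (bigD1 W)//= eqxx big1 ?addr0// => J /andP[_ JW].
  by rewrite eq_sym (negPf JW).
have split0 (f : {set 'I_m} ->
  {poly int}) : \sum_(A : {set 'I_m} | A \subset W) f A =
    f set0 + \sum_(A : {set 'I_m} | (A \subset W) && (A != set0)) f A.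
  by rewrite (bigD1 set0) ?sub0set.
move: swap; rewrite split0 cards0 mul1r setD0; set s1 := (X in _ + X) => swap.
have EM : M W = F W + \sum_(A : {set 'I_m} | (A \subset W) && (A != set0))
    ('X - 1) ^+ #|A| * F (W :\: A) by rewrite /M split0 cards0 mul1r setD0.
move: EM; set s2 := (X in _ + X) => EM.
move: E1; rewrite split0 cards0 mul1r setD0.
have -> : \sum_(A : {set 'I_m} | (A \subset W) && (A != set0))
    ('X - 1) ^+ #|A| * F (x |: (W :\: A)) = 'X * s1 - ('X - 1) * s2.
  rewrite /s1 /s2 !mulr_sumr -sumrB; apply: eq_bigr => A /andP[AW A0].
  rewrite IH.
  - by rewrite mulrBr !(mulrCA _ (_ ^+ _)).
  - exact: leq_trans (card_setD_lt AW A0) Wn.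
  - by rewrite inE (negPf xW) andbF.
rewrite EM -/(conv W) => E1; apply: (mulfI X1).
have {}swap : s1 = 'X * conv W - ('X - 1) *
  F W - conv W by rewrite -swap addrC addKr.
move: E1; rewrite {}swap; move: {EM M} s2 => d;
  move: (F (x |: W)) (conv W) (F W) => a b c E1.
by rewrite mulrBl E1; ring.
Qed.
End FullBuildingSet.

(** * Gamma-vectors of splittable building sets *)

Section NestGamma.
Variable m : nat.
Implicit Types (B : {set {set 'I_m}}) (S T U W A C J : {set 'I_m}).
Local Notation full := (full_building_set m).

Lemma sum_by_card (V : nmodType) W (f : nat -> V) :
  \sum_(J : {set 'I_m} | J \subset W) f #|J| =
    \sum_(j < #|W|.+1) f j *+ 'C(#|W|, j).
Proof.
rewrite (partition_big (fun J : {set 'I_m} =>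
  inord #|J| : 'I_#|W|.+1) xpredT)//=.
apply: eq_bigr => j _; rewrite -cards_draws -sumr_const.
have E J : (J \subset W) && (inord #|J| == j :> 'I_#|W|.+1) =
    (J \in [set J : {set 'I_m} | J \subset W & #|J| == j]).
  rewrite inE; have [JW|//] := boolP (J \subset W).
  by rewrite -val_eqE /= inordK// ltnS subset_leq_card.
by apply: eq_big => [J|J]; rewrite E // inE => /andP[_ /eqP ->].
Qed.

Lemma sum_proper_by_card (V : nmodType) W k (f : nat -> V) : #|W| = k.+1 ->
  \sum_(J : {set 'I_m} | [&& J \subset W, J != set0 & J != W]) f #|J| =
  \sum_(i < k) f i.+1 *+ 'C(k.+1, i.+1).
Proof.
(* Killing the two extreme cardinals reduces to a sum over all subsets. *)
move=> Wk; pose f' j := if (0 < j < k.+1)%N then f j else 0.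
have -> : \sum_(J : {set 'I_m} | [&& J \subset W, J != set0 & J != W]) f #|J| =
    \sum_(J : {set 'I_m} | J \subset W) f' #|J|.
  rewrite big_mkcondr; apply: eq_bigr => J JW.
  by rewrite /f' card_gt0 -Wk [J == W]eqEcard JW ltnNge.
rewrite sum_by_card Wk big_ord_recl big_ord_recr /= /f' /= ltnn !mul0rn add0r
  addr0.
by apply: eq_bigr => i _; rewrite /bump /= add1n ltnS ltn_ord.
Qed.

(** In [hnest_fullU1] the two terms J = set0 and J = W combine with the last one
    to (1 + t) h(W), which is the cone; the other terms only depend on |J|. *)
Lemma has_gamma_full W x : x \notin W ->
  has_gamma #|W| (gammaPe #|W|) (hnest full (x |: W)).
Proof.
have [n] := ubnP #|W|; elim: n W x => // n IH W x Wn xW.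
rewrite hnest_fullU1//.
have [->|W0] := eqVneq W set0.
  rewrite (eq_bigl (pred1 set0)) => [|A]; last by rewrite subset0.
  rewrite big_pred1_eq setD0 hnest0; last exact: full_building.
  by rewrite !mulr1 opprB addrCA subrr addr0 cards0; exact: has_gamma0.
have IH' J : J != set0 -> (#|J| <= n)%N ->
    has_gamma #|J|.-1 (gammaPe #|J|.-1) (hnest full J).
  move=> /set0Pn[y yJ]; have cJ : #|J| = #|J :\ y|.+1 by rewrite (cardsD1 y) yJ.
  rewrite cJ => Jn; have := IH _ y Jn; rewrite setD1K//; apply.
  by rewrite !inE eqxx.
have [k Wk] : exists k, #|W| = k.+1.
  by exists #|W|.-1; rewrite prednK// card_gt0.
rewrite (bigD1 set0) ?sub0set//= (bigD1 W) ?subxx//= setD0 setDv.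
rewrite hnest0; last exact: full_building.
rewrite mul1r mulr1 addrA mulrDr addrAC.
have -> : 'X * (hnest full W + hnest full W) - ('X - 1) * hnest full W =
  (1 + 'X) * hnest full W by ring.
rewrite Wk gammaPeS; apply: has_gammaD.
  apply: has_gammaX1; have := IH' W W0; rewrite Wk; apply.
  by rewrite -ltnS -Wk.
(* The sum over proper nonempty J, read as a sum over |J| = i + 1. *)
pose f j := gammaPe j.-1 * gammaPe (k - j)%N.
have -> : \sum_(i < k) (gammaPe i * gammaPe (k.-1 - i)%N) *+ 'C(k.+1, i.+1) =
    \sum_(i < k) f i.+1 *+ 'C(k.+1, i.+1).
  by apply: eq_bigr => i _; rewrite /f /= -subn1 -subnDA add1n.
rewrite -(sum_proper_by_card f Wk) !mulr_sumr.
under [X in has_gamma _ _ X]eq_bigl do rewrite -andbA.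
apply: has_gamma_sum => J /and3P[JW J0 JnW].
have J1 : (0 < #|J|)%N by rewrite card_gt0.
have Jk : (#|J| < k.+1)%N by rewrite -Wk proper_card// properEneq JnW.
have cD : #|W :\: J| = (k.+1 - #|J|)%N by rewrite cardsD (setIidPr JW) Wk.
have -> : k.+1 = (#|J|.-1 + #|W :\: J|.-1).+2.
  by rewrite cD; move: #|J| J1 Jk => j; lia.
apply: has_gammaX; apply: has_gammaM.
  by apply: IH' => //; apply: leq_trans (ltnW Jk) _; rewrite -Wk.
have -> : (k - #|J| = #|W :\: J|.-1)%N.
  by rewrite cD subSn.
apply: IH'; first by rewrite setD_eq0; apply: contra JnW => WJ;
  rewrite eqEsubset JW.
exact: ltnW (leq_trans (card_setD_lt JW J0) (Wn : (_ <= n)%N)).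
Qed.

Definition has_nonneg_gamma B W := exists g,
  has_gamma (#|W| - #|comps B W|) g (hnest B W) /\ coef_le 0 g.

(** Go from B1 to B2 by the additions of [exists_add].  Those inside W add to
    the h-polynomial t times three factors on fewer vertices than W, of total
    dimension |W| - 3; hence they add t times a nonnegative polynomial to the
    gamma-polynomial. *)
Lemma gamma_mono W B1 B2 g1 :
  (forall B W', building_set B -> splittable B -> (#|W'| < #|W|)%N ->
     has_nonneg_gamma B W') ->
  building_set B1 -> splittable B1 -> building_set B2 -> splittable B2 ->
  B1 \subset B2 -> W \in B1 -> has_gamma #|W|.-1 g1 (hnest B1 W) ->
  exists g2, has_gamma #|W|.-1 g2 (hnest B2 W) /\ coef_le g1 g2.
Proof.
move=> smaller; have [n] := ubnP #|B2 :\: B1|.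
elim: n B1 g1 => // n IH B1 g1 Bn hB1 sB1 hB2 sB2 sub WB1 hg1.
have [E|N] := eqVneq B1 B2.
  by rewrite -E; exists g1; split=> //; exact: coef_le_refl.
have [|U1 [U2 [U1B U2B U12 UB hU]]] := exists_add hB1 hB2 sB2.
  by rewrite properEneq N.
move EU : (U1 :|: U2) UB hU => U UB hU.
have [UB2 UB1] : U \in B2 /\ U \notin B1 by move: UB; rewrite inE => /andP[].
have [g [hg le1]] : exists g,
  has_gamma #|W|.-1 g (hnest (U |: B1) W) /\ coef_le g1 g.
  have [UW|nUW] := boolP (U \subset W); last first.
    exists g1; split; last exact: coef_le_refl.
    suff <- : hnest B1 W = hnest (U |: B1) W by [].
    apply: hnest_ext => T TW; rewrite in_setU1.
    by case: eqP => // ET; rewrite -ET TW in nUW.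
  have ne V : V \in B1 -> (0 < #|V|)%N.
    by case: hB1 => B0 _ _ VB; rewrite card_gt0; apply: contraNneq B0 => <-.
  have nUW : U != W by apply: contraNneq UB1 => ->.
  have ltUW : (#|U| < #|W|)%N by rewrite proper_card// properEneq nUW.
  have cU : (#|U1| + #|U2| = #|U|)%N by rewrite -EU cardUdisj.
  have cD : #|W :\: U| = (#|W| - #|U|)%N by rewrite cardsD (setIidPr UW).
  have part V : V \in B1 -> (#|V| <= #|U|)%N ->
      exists g, has_gamma #|V|.-1 g (hnest B1 V) /\ coef_le 0 g.
    move=> VB VU; have := smaller B1 V hB1 sB1 (leq_ltn_trans VU ltUW).
    by rewrite /has_nonneg_gamma comps_conn// cards1 subn1.
  have [|ga [hga a0]] := part _ U1B; first by rewrite -cU leq_addr.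
  have [|gb [hgb b0]] := part _ U2B; first by rewrite -cU leq_addl.
  have hK := contract_building U hB1.
  have WUK : W :\: U \in contract B1 U.
    apply/contractP; left; split; last by exists W.
    by rewrite setD_eq0; apply: contra nUW => WU; rewrite eqEsubset UW.
  have U0 : U != set0 by case: hU => B0 _ _; apply: contraNneq B0 => <-;
    rewrite setU11.
  have := smaller _ (W :\: U) hK (contract_splittable (S :=
    U) hB1 sB1) (card_setD_lt UW U0).
  rewrite /has_nonneg_gamma comps_conn// cards1 subn1 => -[gc [hgc c0]].
  exists (g1 + 'X * (ga * gb * gc)); split.
    rewrite (hnest_add hB1 hU UB1 U1B U2B U12 (esym EU) UW).
    apply: has_gammaD => //.
    have -> : #|W|.-1 = (#|U1|.-1 + #|U2|.-1 + #|W :\: U|.-1).+2.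
      move: (ne _ U1B) (ne _ U2B) cU cD ltUW.
      by move: #|U1| #|U2| #|U| #|W :\: U| #|W|; clear; lia.
    by apply: has_gammaX; apply: has_gammaM hgc; exact: has_gammaM.
  rewrite -[X in coef_le X _]addr0; apply: coef_leD; first exact: coef_le_refl.
  by do !apply: coef_leM => //; exact: coef_leX.
have subU : U |: B1 \subset B2 by rewrite subUset sub1set UB2.
have less : (#|B2 :\: (U |: B1)| < n)%N.
  apply: leq_trans (Bn : (_ <= n)%N); apply: proper_card; apply/properP; split.
    by apply: setDS; exact: subsetUr.
  by exists U; rewrite // !inE eqxx.
have WU : W \in U |: B1 by rewrite in_setU1 WB1 orbT.
have sU := splittableU1 sB1 U1B U2B U12 (esym EU).
have [g' [hg' le2]] := IH _ g less hU sU hB2 sB2 subU WU hg.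
by exists g'; split=> //; exact: coef_le_trans le1 le2.
Qed.

(** For a splitting W = S1 :|: S2 in B, the starting point on the way up to B is
    the cone over the separate restrictions of B to S1 and S2. *)
Section Restrict2.
Variables (B : {set {set 'I_m}}) (W S1 S2 : {set 'I_m}).
Hypotheses (hB : building_set B) (sB : splittable B).
Hypotheses (S1B : S1 \in B) (S2B : S2 \in B) (S12 : S1 :&: S2 = set0).
Hypothesis (EW : W = S1 :|: S2).

Definition restrict2 : {set {set 'I_m}} :=
  [set S in B | [|| S \subset S1, S \subset S2 | #|S| == 1%N]].

Lemma restrict2P S : reflect (S \in B /\ [\/ S \subset S1,
  S \subset S2 | exists x, S = [set x]])
  (S \in restrict2).
Proof.
rewrite inE; apply: (iffP andP) => -[SB H]; split=> //.
  by case/or3P: H => [H|H|/cards1P H]; [apply: Or31|apply: Or32|apply: Or33].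
case: H => [->//|->|[x ->]]; first by rewrite orbT.
by rewrite cards1 !orbT.
Qed.

Lemma restrict2_building : building_set restrict2.
Proof.
have [B0 B1 BU] := hB; split.
- by apply/negP => /restrict2P[]; rewrite (negPf B0).
- by move=> x; apply/restrict2P; split=> //; apply: Or33; exists x.
have apart S T : S \subset S1 -> T \subset S2 -> S :&: T != set0 -> False.
  by move=> SS TS /eqP[]; exact: disjSS S12 SS TS.
move=> S T SP TP ST; case/restrict2P: (SP) => SB hS;
  case/restrict2P: (TP) => TB hT.
case: hS => [hS|hS|[x Sx]]; last first.
- suff /setUidPr -> : S \subset T by [].
  case/set0Pn: ST => y; rewrite Sx inE sub1set => /andP[/set1P -> //].
- case: hT => [hT|hT|[x Tx]].
  + by case: (apart T S) => //; rewrite setIC.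
  + by apply/restrict2P; split; [exact: BU|apply: Or32; rewrite subUset hS].
  suff /setUidPl -> : T \subset S by [].
  by case/set0Pn: ST => y; rewrite Tx inE sub1set => /andP[yS /set1P <-].
case: hT => [hT|hT|[x Tx]].
- by apply/restrict2P; split; [exact: BU|apply: Or31; rewrite subUset hS].
- by case: (apart S T).
suff /setUidPl -> : T \subset S by [].
by case/set0Pn: ST => y; rewrite Tx inE sub1set => /andP[yS /set1P <-].
Qed.

Lemma restrict2_splittable : splittable restrict2.
Proof.
move=> S /restrict2P[SB hS] S1lt; have [P [Q [PB QB PQ E]]] := sB SB S1lt.
have PS : P \subset S by rewrite E subsetUl.
have QS : Q \subset S by rewrite E subsetUr.
exists P, Q; split=> //; apply/restrict2P; split=> //;
  case: hS => [hS|hS|[x Sx]].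
- by apply: Or31; exact: subset_trans hS.
- by apply: Or32; exact: subset_trans hS.
- by move: S1lt; rewrite Sx cards1.
- by apply: Or31; exact: subset_trans hS.
- by apply: Or32; exact: subset_trans hS.
- by move: S1lt; rewrite Sx cards1.
Qed.

Lemma restrict2U1_building : building_set (W |: restrict2).
Proof.
have [B0 B1 BU] := restrict2_building.
have W0 : W != set0.
  apply: contraNneq (let: And3 B0 _ _ := hB in B0) => E.
  by suff <- : S1 = set0 by []; apply/eqP; rewrite -subset0 -E EW subsetUl.
have sub T : T \in restrict2 -> T :&: W != set0 -> T \subset W.
  case/restrict2P=> _ [TS|TS|[x ->]].
  - by move=> _; rewrite EW; exact: subset_trans TS (subsetUl _ _).
  - by move=> _; rewrite EW; exact: subset_trans TS (subsetUr _ _).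
  by case/set0Pn=> y; rewrite inE sub1set => /andP[/set1P ->].
split.
- by rewrite in_setU1 negb_or eq_sym W0.
- by move=> x; rewrite in_setU1 B1 orbT.
move=> S T; rewrite !in_setU1 => /predU1P[->|SB] /predU1P[->|TB] ST.
- by rewrite setUid eqxx.
- by rewrite (setUidPl (sub _ TB _)) ?eqxx// setIC.
- by rewrite (setUidPr (sub _ SB _)) ?eqxx.
- by rewrite BU ?orbT.
Qed.

Lemma restrict2_mem : S1 \in restrict2 /\ S2 \in restrict2.
Proof. by split; apply/restrict2P; split=> //; [apply: Or31|apply: Or32]. Qed.

Lemma restrict2_notin : W \notin restrict2.
Proof.
have ne V : V \in B -> exists x, x \in V.
  by case: hB => B0 _ _ VB; apply/set0Pn; apply: contraNneq B0 => <-.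
have [x x1] := ne _ S1B; have [y y2] := ne _ S2B.
have x2 : x \notin S2 by have := in_set0 x; rewrite -S12 inE x1 => /= ->.
have y1 : y \notin S1 by have := in_set0 y; rewrite -S12 inE y2 andbT => ->.
have xW : x \in W by rewrite EW inE x1.
have yW : y \in W by rewrite EW inE y2 orbT.
apply/negP => /restrict2P[_ [/subsetP/(_ y yW)|/subsetP/(_ x xW)|[z Wz]]].
- by rewrite (negPf y1).
- by rewrite (negPf x2).
move: xW yW; rewrite Wz => /set1P E /set1P E'.
by rewrite E' -E x1 in y1.
Qed.

End Restrict2.

(** Strong induction on W.  A disconnected W is a product.  If W is in B, write
    W = S1 :|: S2 with both parts in B: the cone over B|S1 and B|S2 has the
    nonnegative gamma-polynomial gamma(B|S1) gamma(B|S2), and [gamma_mono]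
    transports this up to B and compares B with the full building set. *)
Lemma nest_gamma B W : building_set B -> splittable B ->
  exists g, [/\ has_gamma (#|W| - #|comps B W|) g (hnest B W), coef_le 0 g &
    coef_le g (gammaPe (#|W| - #|comps B W|))].
Proof.
have [n] := ubnP #|W|; elim: n B W => // n IH B W Wn hB sB.
have [->|W0] := eqVneq W set0.
  exists 1; rewrite comps0// cards0 hnest0//.
  by split; [exact: has_gamma0|exact: coef_le1|exact: coef_le_refl].
have [WB|WB] := boolP (W \in B); last first.
  have /set0Pn[x xW] := W0; have [C CW xC] := comps_cover hB xW.
  have /compsP[CB CsW Cm] := CW.
  have dC : C :&: (W :\: C) = set0 by rewrite setIDA setIC -setIDA setDv setI0.
  have EW : C :|: (W :\: C) = W by rewrite -{2}(setID W C) (setIidPr CsW).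
  have spl S : S \in B -> S \subset C :|: (W :\: C) ->
    (S \subset C) || (S \subset W :\: C).
    move=> SB; rewrite EW => SW; have [SC|SC] := eqVneq (S :&: C) set0.
      by rewrite subsetD SW -setI_eq0 SC eqxx orbT.
    by rewrite Cm.
  have ltC : (#|C| < #|W|)%N.
    by apply: proper_card; rewrite properEneq CsW andbT;
      apply: contraNneq WB => <-.
  have ltD : (#|W :\: C| < #|W|)%N.
    by apply: card_setD_lt => //; apply/set0Pn; exists x.
  have [g1 [hg1 p1 u1]] := IH B C (leq_trans ltC Wn) hB sB.
  have [g2 [hg2 p2 u2]] := IH B _ (leq_trans ltD Wn) hB sB.
  have [Ec Ec0] := comps_split hB dC spl.
  have h1 : (#|comps B C| <= #|C|)%N.
    by apply: (@hits_card _ _ _ C hB); apply/hitsP; split=> // D DC;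
      have /compsP[_ DsC _] := DC; rewrite (setIidPr DsC) (comps_neq0 hB DC).
  have h2 : (#|comps B (W :\: C)| <= #|W :\: C|)%N.
    by apply: (@hits_card _ _ _ (W :\: C) hB); apply/hitsP; split=> // D DC;
      have /compsP[_ DsC _] := DC; rewrite (setIidPr DsC) (comps_neq0 hB DC).
  have -> : (#|W| - #|comps B W| =
      (#|C| - #|comps B C|) + (#|W :\: C| - #|comps B (W :\: C)|))%N.
    rewrite -{1 2}EW Ec !cardUdisj//; move: h1 h2; clear.
    by move: #|C| #|W :\: C| #|comps B C| #|comps B (W :\: C)| => a b c d; lia.
  exists (g1 * g2); split.
  - by rewrite -{3}EW hnestM//; exact: has_gammaM.
  - exact: coef_leM.
  apply: coef_le_trans (gammaPeM _ _).
  by apply: (coef_le_trans (coef_leMl p1 u2));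
    exact: coef_leMr (gammaPe_ge0 _) u1.
rewrite comps_conn// cards1 subn1.
have [g0 [hg0 p0]] : exists g, has_gamma #|W|.-1 g (hnest B W) /\ coef_le 0 g.
  have [W1|W1] := leqP #|W| 1.
    have /cards1P[x Wx] : #|W| == 1%N by rewrite eqn_leq W1 card_gt0.
    exists 1; split; last exact: coef_le1.
    have -> : hnest B W = hnest full (x |: set0).
      rewrite setU0 -Wx; apply: hnest_ext => T; rewrite Wx subset1.
      case/orP=> /eqP ->; first by rewrite -Wx WB Wx;
        case: (full_building m) => _ ->.
      by case: hB (full_building m) => /negPf-> _ _ [/negPf-> _ _].
    by have := @has_gamma_full set0 x; rewrite cards0 Wx cards1 inE; apply.
  have [S1 [S2 [S1B S2B S12 EW]]] := sB W WB W1.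
  pose B0 := restrict2 B S1 S2.
  have hB0 : building_set B0 by exact: restrict2_building.
  have sB0 : splittable B0 by exact: restrict2_splittable.
  have hB1 : building_set (W |: B0) by exact: restrict2U1_building EW.
  have [S1B0 S2B0] : S1 \in B0 /\ S2 \in B0 := restrict2_mem S1B S2B.
  have WB0 : W \notin B0 := restrict2_notin hB S1B S2B S12 EW.
  have smaller B' W' : building_set B' -> splittable B' -> (#|W'| < #|W|)%N ->
      has_nonneg_gamma B' W'.
    move=> hB' sB' W'W; have [g [h1 h2 _]] :=
      IH B' W' (leq_trans W'W Wn) hB' sB'.
    by exists g.
  have cW : (#|S1| + #|S2| = #|W|)%N by rewrite EW cardUdisj.
  have ne V : V \in B -> (0 < #|V|)%N.
    by case: hB => B0' _ _ VB; rewrite card_gt0; apply: contraNneq B0' => <-.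
  have n1 := ne _ S1B; have n2 := ne _ S2B.
  have l1 : (#|S1| < #|W|)%N by rewrite -cW -[ltnLHS]addn0 ltn_add2l.
  have l2 : (#|S2| < #|W|)%N by rewrite -cW -[ltnLHS]add0n ltn_add2r.
  have := smaller _ _ hB0 sB0 l1;
    rewrite /has_nonneg_gamma comps_conn// cards1 subn1.
  case=> ga [hga a0].
  have := smaller _ _ hB0 sB0 l2;
    rewrite /has_nonneg_gamma comps_conn// cards1 subn1.
  case=> gb [hgb b0].
  have hg0 : has_gamma #|W|.-1 (ga * gb) (hnest (W |: B0) W).
    rewrite (hnest_cone hB0 hB1 WB0 S1B0 S2B0 S12 EW).
    have -> : #|W|.-1 = (#|S1|.-1 + #|S2|.-1).+1.
      by rewrite -cW; move: #|S1| #|S2| n1 n2; clear; lia.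
    by apply: has_gammaX1; exact: has_gammaM.
  have sub : W |: B0 \subset B.
    by rewrite subUset sub1set WB; apply/subsetP => S /restrict2P[].
  have sB1 := splittableU1 sB0 S1B0 S2B0 S12 EW.
  have [g [hg le]] := gamma_mono smaller hB1 sB1 hB sB sub (setU11 _ _) hg0.
  exists g; split=> //; apply: coef_le_trans le; exact: coef_leM.
have [g1 [hg1 g01]] : exists g1,
  has_gamma #|W|.-1 g1 (hnest full W) /\ coef_le g0 g1.
  apply: (@gamma_mono W B full g0) => //.
  - move=> B' W' hB' sB' W'W;
    have [g [h1 h2 _]] := IH B' W' (leq_trans W'W Wn) hB' sB'.
    by exists g.
  - exact: full_building.
  - exact: full_splittable.
  - exact: building_sub_full.
exists g0; split=> //.
suff <- : g1 = gammaPe #|W|.-1 by [].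
apply: has_gamma_uniq hg1 _; have /set0Pn[x xW] := W0.
have cW : #|W| = #|W :\ x|.+1 by rewrite (cardsD1 x) xW.
have /has_gamma_full : x \notin W :\ x by rewrite !inE eqxx.
by rewrite setD1K// cW.
Qed.
End NestGamma.

(** * Faces of a nestohedron and their dimensions *)

Section Faces.
Variables (R : realType) (m : nat).
Implicit Types (B : {set {set 'I_m}}) (S T U W A C : {set 'I_m})
  (a x y : 'rV[R]_m).

Definition dot a x : R := \sum_i a 0 i * x 0 i.

Lemma dot_sum (I : finType) (P : pred I) a (y : I -> 'rV[R]_m) :
  dot a (\sum_(S | P S) y S) = \sum_(S | P S) dot a (y S).
Proof.
rewrite /dot exchange_big /=; apply: eq_bigr => i _.
by rewrite summxE mulr_sumr.
Qed.

Lemma std_simplexP S x : std_simplex S x <->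
  [/\ forall i, 0 <= x 0 i, forall i, i \notin S ->
    x 0 i = 0 & \sum_i x 0 i = 1].
Proof.
have E (w : 'I_m -> R) j :
    (\sum_(i in S) w i *: (delta_mx 0 i : 'rV[R]_m)) 0 j =
      if j \in S then w j else 0.
  rewrite summxE; have [jS|jS] := boolP (j \in S).
    rewrite (bigD1 j)//= !mxE !eqxx mulr1 big1 ?addr0// => i /andP[_ ij].
    by rewrite !mxE eqxx eq_sym (negPf ij) mulr0.
  rewrite big1// => i iS; rewrite !mxE eqxx /=; case: eqP => [E|_];
    last by rewrite mulr0.
  by rewrite E iS in jS.
split=> [[w [w0 w1 ->]]|[x0 xS x1]].
  split=> [i|i iS|]; rewrite ?E ?(negPf iS)//; first by case: ifP => // /w0.
  by under eq_bigr do rewrite E; rewrite -big_mkcond.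
exists (fun i => x 0 i); split=> //.
  rewrite -x1 [RHS](bigID (fun i => i \in S)) /= [X in _ = _ + X]big1 ?addr0//.
by apply/rowP => j; rewrite E; case: ifPn => // /xS.
Qed.

Lemma vertex_simplex S i : i \in S -> std_simplex S (delta_mx 0 i : 'rV[R]_m).
Proof.
move=> iS; apply/std_simplexP; split=> [j|j jS|].
- by rewrite mxE ler0n.
- by rewrite mxE eqxx /=; case: eqP => // E; rewrite E iS in jS.
rewrite (bigD1 i)//= mxE !eqxx big1 ?addr0// => j ji.
by rewrite mxE eqxx (negPf ji).
Qed.

Definition argmx a S := [set i in S | [forall j in S, a 0 j <= a 0 i]].

Lemma argmxP a S i : reflect (i \in S /\ forall j, j \in S -> a 0 j <= a 0 i)
  (i \in argmx a S).
Proof.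
by rewrite inE; apply: (iffP andP) => -[iS /forall_inP].
Qed.

Lemma argmx_sub a S : argmx a S \subset S.
Proof. by apply/subsetP => i /argmxP[]. Qed.

Lemma argmx_neq0 a S : S != set0 -> argmx a S != set0.
Proof.
move=> /set0Pn[i iS]; apply/set0Pn.
case: (@arg_maxP _ _ _ i (mem S) (fun i => a 0 i) iS) => j jS jmax.
by exists j; apply/argmxP.
Qed.

(** The maximum of a over S, that is, the support function of the simplex. *)
Definition simplex_max a S : R :=
  if [pick i in argmx a S] is Some i then a 0 i else 0.

Lemma simplex_maxE a S i : i \in argmx a S -> simplex_max a S = a 0 i.
Proof.
move=> iS; rewrite /simplex_max; case: pickP => [j jS|/(_ i)];
  last by rewrite iS.
by case/argmxP: iS jS => iS i1 /argmxP[jS j1]; apply: le_anti; rewrite i1// j1.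
Qed.

Lemma simplex_max_ge a S i : i \in S -> a 0 i <= simplex_max a S.
Proof.
move=> iS; have /set0Pn[j jS] : argmx a S != set0.
  by apply/argmx_neq0/set0Pn; exists i.
by rewrite (simplex_maxE jS); case/argmxP: jS => _; apply.
Qed.

Lemma dot_simplex a S y : std_simplex S y ->
  dot a y <= simplex_max a S /\ (dot a y =
    simplex_max a S <-> std_simplex (argmx a S) y).
Proof.
move=> /std_simplexP[y0 yS y1].
have D : simplex_max a S - dot a y = \sum_i (simplex_max a S - a 0 i) * y 0 i.
  rewrite /dot; under [RHS]eq_bigr do rewrite mulrBl.
  by rewrite sumrB -mulr_sumr y1 mulr1.
have T0 i : 0 <= (simplex_max a S - a 0 i) * y 0 i.
  have [iS|iS] := boolP (i \in S); last by rewrite yS// mulr0.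
  by rewrite mulr_ge0// subr_ge0 simplex_max_ge.
split; first by rewrite -subr_ge0 D; apply: sumr_ge0.
split=> [E|/std_simplexP[_ yA _]].
  apply/std_simplexP; split=> // i iA.
  have [iS|/yS //] := boolP (i \in S).
  move: D; rewrite E subrr => /esym/eqP; rewrite psumr_eq0// => /allP/(_ i).
  rewrite mem_index_enum => /(_ isT) /=; rewrite mulf_eq0 => /orP[|/eqP//].
  rewrite subr_eq0 => /eqP Ei; case/negP: iA; apply/argmxP; split=> // j jS.
  by rewrite -Ei simplex_max_ge.
apply/esym/eqP; rewrite -subr_eq0 D big1// => i _.
have [iA|iA] := boolP (i \in argmx a S);
  first by rewrite (simplex_maxE iA) subrr mul0r.
by rewrite yA// mulr0.
Qed.

Section Nesto.
Variable B : {set {set 'I_m}}.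
Hypothesis hB : building_set B.

Lemma B_neq0 S : S \in B -> S != set0.
Proof. by case: hB => B0 _ _; apply: contraTneq => ->. Qed.

Definition face_sum (phi : {set 'I_m} -> {set 'I_m}) : set 'rV[R]_m :=
  minkowski_sum B (fun S => std_simplex (phi S)).

Definition nest_max a : R := \sum_(S in B) simplex_max a S.

(** A functional is maximal on a sum exactly when it is maximal on every
    summand; this holds for every decomposition of the point. *)
Lemma dot_nest_max a (y : {set 'I_m} -> 'rV[R]_m) :
  (forall S, S \in B -> std_simplex S (y S)) ->
  dot a (\sum_(S in B) y S) <= nest_max a /\
  (dot a (\sum_(S in B) y S) = nest_max a ->
    forall S, S \in B -> std_simplex (argmx a S) (y S)).
Proof.
move=> yS; rewrite dot_sum /nest_max.
have D S (SB : S \in B) := dot_simplex a (yS S SB).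
split; first by apply: ler_sum => S /D[].
move=> E S SB; have [_ [H _]] := D S SB; apply: H; apply/esym/eqP;
  rewrite -subr_eq0.
have /eqP : \sum_(S in B) (simplex_max a S - dot a (y S)) =
  0 by rewrite sumrB E subrr.
rewrite psumr_eq0 => [/allP/(_ S)|T /D[+ _]]; last by rewrite subr_ge0.
by rewrite mem_index_enum SB => /(_ isT).
Qed.

Lemma simplexS S T x : S \subset T -> std_simplex S x -> std_simplex T x.
Proof.
move=> /subsetP ST /std_simplexP[x0 xS x1]; apply/std_simplexP; split=> // i iT.
by apply: xS; apply: contra iT; exact: ST.
Qed.

Lemma face_sum_argmx a x :
  face_sum (argmx a) x <-> nestohedron R B x /\ dot a x = nest_max a.
Proof.
split=> [[y [yS ->]]|[[y [yS ->]] E]].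
  split; first by exists y; split=> // S /yS; apply/simplexS/argmx_sub.
  rewrite dot_sum; apply: eq_bigr => S SB.
  have yS' := yS S SB; have /(dot_simplex a)[_ [_]] :=
    simplexS (argmx_sub _ _) yS'.
  exact.
exists y; split=> //; exact: (dot_nest_max a yS).2.
Qed.

Lemma face_sum_neq0 (phi : {set 'I_m} -> {set 'I_m}) :
  (forall S, S \in B -> phi S != set0) -> exists x, face_sum phi x.
Proof.
move=> H.
pose y S : 'rV[R]_m := if [pick i in phi S] is Some i then delta_mx 0 i else 0.
exists (\sum_(S in B) y S); exists y; split=> // S SB; rewrite /y;
  case: pickP => [i iS|E]; first exact: vertex_simplex.
by have /set0Pn[i] := H S SB; rewrite E.
Qed.

Lemma face_sum_face a : face (nestohedron R B) (face_sum (argmx a)).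
Proof.
exists a, (nest_max a); split; first by move=> x [y [yS ->]];
  exact: (dot_nest_max a yS).1.
by apply/funext => x; apply/propext; exact: face_sum_argmx.
Qed.

Lemma argmxB_neq0 a S : S \in B -> argmx a S != set0.
Proof. by move/B_neq0; exact: argmx_neq0. Qed.

Lemma faceE (F : set 'rV[R]_m) : face (nestohedron R B) F ->
  (F !=set0)%classic ->
  exists a, F = face_sum (argmx a).
Proof.
move=> [a [b [valid EF]]] [x Fx]; exists a.
suff Eb : b = nest_max a.
  rewrite EF Eb; apply/funext => z; apply/propext; apply: iff_sym.
  exact: face_sum_argmx.
have [z /face_sum_argmx[zP zE]] := face_sum_neq0 (@argmxB_neq0 a).
apply/le_anti/andP; split; last by rewrite -zE; exact: valid.
move: Fx; rewrite EF => -[[y [yS ->]] <-]; exact: (dot_nest_max a yS).1.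
Qed.

(** Put a vertex i of argmx a S in the decomposition of a point of the face of
    a.  If the face of b is the same, then b is maximal at this point, so i is
    in argmx b S. *)
Lemma face_sum_argmx_sub a b : face_sum (argmx a) = face_sum (argmx b) ->
  forall S, S \in B -> argmx a S \subset argmx b S.
Proof.
move=> E S SB; apply/subsetP => i iS.
(* A point of the face of a whose summand for S is the vertex i. *)
pose y T : 'rV[R]_m := if T == S then delta_mx 0 i else
  if [pick j in argmx a T] is Some j then delta_mx 0 j else 0.
have yT T : T \in B -> std_simplex (argmx a T) (y T).
  move=> TB; rewrite /y; case: eqP => [->|_]; first exact: vertex_simplex.
  case: pickP => [j jT|E']; first exact: vertex_simplex.
  by have /set0Pn[j] := argmxB_neq0 a TB; rewrite E'.
have /face_sum_argmx[_ Eb] : face_sum (argmx b)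
  (\sum_(T in B) y T) by rewrite -E; exists y.
have yT' T : T \in B -> std_simplex T (y T).
  by move/yT; apply/simplexS/argmx_sub.
have /std_simplexP[_ H _] := (dot_nest_max b yT').2 Eb S SB.
apply: contraT => /H; rewrite /y eqxx mxE !eqxx => /eqP.
by rewrite oner_eq0.
Qed.

Lemma face_sum_argmx_inj a b : face_sum (argmx a) = face_sum (argmx b) ->
  forall S, S \in B -> argmx a S = argmx b S.
Proof.
by move=> E S SB; apply/eqP; rewrite eqEsubset !face_sum_argmx_sub.
Qed.

(** Suppose that the values of phi on B are all contained in blocks of a
    partition P of the vertices and that every block is such a value.  Then the
    sum of the simplices on the phi S spans the directions e_i - e_j for i and j
    in the same block, a space of dimension m - |P|.  A representative rho i is
    chosen in each block, and the vectors e_i - e_(rho i) for i not a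
    representative are a basis. *)
Section Dimension.
Variables (phi : {set 'I_m} -> {set 'I_m}) (P : {set {set 'I_m}}).
Hypothesis phi0 : forall S, S \in B -> phi S != set0.
Hypothesis partP : partition P [set: 'I_m].
Hypothesis phiP : forall S, S \in B -> exists2 b, b \in P & phi S \subset b.
Hypothesis Pphi : forall b, b \in P -> exists2 S, S \in B & b = phi S.

Let X := transversal P [set: 'I_m].
Let rho i := transversal_repr i X (pblock P i).

Let Pcover i : i \in cover P.
Proof. by rewrite (cover_partition partP) inE. Qed.

Let rhoP i : rho i \in X /\ rho i \in pblock P i.
Proof.
have tX := transversalP partP.
have bP : pblock P i \in P by rewrite pblock_mem ?Pcover.
by split; [exact: (repr_mem_transversal tX)|exact: (repr_mem_pblock tX)].
Qed.

Let rho_block b i j : b \in P -> i \in b -> j \in b -> rho i = rho j.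
Proof.
move=> bP ib jb; have [_ tP _] := and3P partP.
have tX := transversalP partP.
rewrite /rho (def_pblock tP bP ib) (def_pblock tP bP jb).
by apply: set1_inj; rewrite -!(setI_transversal_pblock tX).
Qed.
Let rho_id i : i \in X -> rho i = i.
Proof. by move=> iX; exact: (pblockK (transversalP partP)). Qed.

Let N := #|~: X|.
Let e (k : 'I_N) : 'I_m := enum_val k.
Let v (i : 'I_m) : 'rV[R]_m := delta_mx 0 i.

Let e_notin k : e k \notin X.
Proof. by have := enum_valP k; rewrite inE. Qed.

Let M : 'M[R]_(N, m) := \matrix_(k < N) (v (e k) - v (rho (e k))).

Let M_free : row_free M.
Proof.
apply/row_freeP; exists (\matrix_(i < m, k < N) (i == e k)%:R).
apply/matrixP => k l; rewrite !mxE.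
rewrite (bigD1 (e l))//= big1 ?addr0 => [|i il]; last first.
  by rewrite [X in _ * X]mxE (negPf il) mulr0.
rewrite !mxE !eqxx mulr1 /= [e l == rho _]eq_sym.
have -> : (rho (e k) == e l) = false.
  by apply: contraTF (rhoP (e k)).1 => /eqP ->; exact: e_notin.
by rewrite subr0 eq_sym (inj_eq enum_val_inj).
Qed.

(** The coordinates of a point sum up over each block to a constant, so that
    differences of points are combinations of the e_i - e_(rho i). *)
Let face_sum_rho : exists c : 'rV[R]_m, forall x, face_sum phi x ->
  x *m (\matrix_(i < m) v (rho i)) = c.
Proof.
pose r S : 'rV[R]_m := if [pick i in phi S] is Some i then v (rho i) else 0.
exists (\sum_(S in B) r S) => _ [y [yS ->]]; rewrite mulmx_suml.
apply: eq_bigr => S SB; have /std_simplexP[_ y0 y1] := yS S SB.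
have [b bP sb] := phiP SB; rewrite /r; case: pickP => [i iS|E]; last first.
  by have /set0Pn[i] := phi0 SB; rewrite E.
rewrite mulmx_sum_row -[RHS]scale1r -y1 scaler_suml; apply: eq_bigr => j _.
rewrite rowK; have [jS|/y0 ->] := boolP (j \in phi S); last by rewrite !scale0r.
by rewrite (rho_block bP (subsetP sb j jS) (subsetP sb i iS)).
Qed.

Let affdim_le : (affdim (face_sum phi) <= N)%N.
Proof.
apply/bigmax_leqP => k /asboolP[p [pfree pQ]].
have [c Hc] := face_sum_rho.
rewrite -(eqP pfree); apply: leq_trans (rank_leq_row M); apply: mxrankS.
apply/row_subP => i; rewrite rowK.
set d := _ - _; have Ed : d = d *m (\matrix_(i < m) (v i - v (rho i))).
  rewrite (_ : (\matrix_i (v i - v (rho i))) = 1%:M - \matrix_i v (rho i)).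
    by rewrite mulmxBr mulmx1 /d mulmxBl !Hc// subrr subr0.
  by apply/row_matrixP => j; rewrite rowK linearB /= row1 rowK.
rewrite Ed; apply: submx_trans (submxMl _ _) _; apply/row_subP => j;
  rewrite rowK.
have [jX|jX] := boolP (j \in X); first by rewrite rho_id// subrr sub0mx.
have jX' : j \in ~: X by rewrite inE.
have <- : row (enum_rank_in jX' j) M = v j - v (rho j).
  by rewrite rowK /e enum_rankK_in.
exact: row_sub.
Qed.

(** The base point has, in the summand of each block, the vertex rho i, so it
    stays in the polytope when this vertex is moved to i. *)
Let affdim_ge : (N <= affdim (face_sum phi))%N.
Proof.
have Nm : (N < m.+1)%N by rewrite ltnS -[X in (_ <= X)%N]card_ord;
  exact: max_card.
(* For a block phi S the selected vertex is its representative. *)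
pose sel S : 'rV[R]_m := if [pick i in phi S] is Some i then
  (if rho i \in phi S then v (rho i) else v i) else 0.
have selP S : S \in B -> std_simplex (phi S) (sel S).
  move=> SB; rewrite /sel; case: pickP => [i iS|E].
    by case: ifP => ri; exact: vertex_simplex.
  by have /set0Pn[i] := phi0 SB; rewrite E.
pose p (j : 'I_N.+1) := \sum_(S in B) sel S +
  if unlift ord0 j is Some k then v (e k) - v (rho (e k)) else 0.
apply: (@leq_bigmax_cond _ _ _ (Ordinal Nm)); apply/asboolP; exists p; split.
  rewrite /affinely_independent.
  suff -> : \matrix_(i < N) (p (lift ord0 i) - p ord0) = M by exact: M_free.
  apply/row_matrixP => k; rewrite !rowK /p liftK unlift_none addr0.
  by rewrite addrC addKr.
move=> j; rewrite /p; case: (unlift ord0 j) => [k|]; last first.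
  by rewrite addr0; exists sel.
have bP : pblock P (e k) \in P by rewrite pblock_mem ?Pcover.
have [S SB Eb] := Pphi bP.
have ekb : e k \in phi S by rewrite -Eb mem_pblock.
have rekb : rho (e k) \in phi S by rewrite -Eb; exact: (rhoP _).2.
have selS : sel S = v (rho (e k)).
  rewrite /sel; case: pickP => [i iS|/(_ (e k))]; last by rewrite ekb.
  have -> : rho i = rho (e k) by apply: (rho_block bP); rewrite Eb.
  by rewrite rekb.
exists (fun T => if T == S then v (e k) else sel T); split.
  move=> T TB; case: eqP => [->|_]; last exact: selP.
  exact: vertex_simplex.
rewrite (bigD1 S)//= [RHS](bigD1 S)//= eqxx selS [LHS]addrC [LHS]addrA subrK.
congr (_ + _); apply: eq_bigr => T /andP[_ TS].
by rewrite (negPf TS).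
Qed.

Lemma affdim_face_sum : affdim (face_sum phi) = (m - #|P|)%N.
Proof.
apply/eqP; rewrite eqn_leq -(card_transversal (transversalP partP)) -/X.
have -> : (m - #|X|)%N = N by rewrite /N [RHS]cardsCs setCK card_ord.
by rewrite affdim_le affdim_ge.
Qed.
End Dimension.
End Nesto.
End Faces.

(** * The recursion for the faces *)

Section FaceRecursion.
Variables (R : realType) (m : nat) (B : {set {set 'I_m}}).
Hypothesis hB : building_set B.
Implicit Types (S T U W A C : {set 'I_m}) (a : 'rV[R]_m).
Implicit Types (f : {ffun {set 'I_m} -> {set 'I_m}}) (P : {set {set 'I_m}}).

(** The face of B|W selected by a, encoded by the sets where a is maximal; the
    value set0 outside B|W makes the encoding unique. *)
Definition argmap W a : {ffun {set 'I_m} -> {set 'I_m}} :=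
  [ffun S => if (S \in B) && (S \subset W) then argmx a S else set0].

Definition top_level f W := \bigcup_(C in comps B W) f C.

(** The hypotheses under which [affdim_face_sum] computes the dimension of the
    face encoded by f. *)
Definition is_blocks f W P := [/\ partition P W,
  forall S, S \in B -> S \subset W -> exists2 b, b \in P & f S \subset b &
  forall b, b \in P -> exists S, [/\ S \in B, S \subset W & b = f S]].

(** The only possible P in [is_blocks] consists of the maximal values of f; this
    makes the dimension a function of f. *)
Definition blocks f W := [set f S | S in B & (S \subset W) &&
  [forall T in B, (T \subset W) ==> (f S \subset f T) ==> (f T == f S)]].

Lemma is_blocksE f W P : (forall S, S \in B -> S \subset W -> f S != set0) ->
  is_blocks f W P -> blocks f W = P.
Proof.
move=> f0 [partP fP Pf]; have [_ tP _] := and3P partP.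
have uniq_block b b' : b \in P -> b' \in P -> b :&: b' != set0 -> b = b'.
  move=> bP b'P; apply: contra_neq_eq => bb'.
  by apply/eqP; rewrite setI_eq0; exact: (trivIsetP tP).
have P0 b : b \in P -> b != set0.
  by move=> /Pf[S [SB SW ->]]; exact: f0.
apply/setP => b; apply/imsetP/idP => [[S]|bP].
  rewrite inE => /and3P[SB SW Smax] ->.
  have [b' b'P Sb'] := fP S SB SW; have [T [TB TW E]] := Pf _ b'P.
  move: Smax => /forall_inP/(_ T TB); rewrite TW -E Sb' /= => /eqP <-.
  by [].
have [S [SB SW E]] := Pf b bP; exists S => //.
rewrite inE SB SW /=; apply/forall_inP => T TB; apply/implyP => TW.
apply/implyP => ST; rewrite eqEsubset ST andbT -E.
have [b' b'P Tb'] := fP T TB TW; rewrite (uniq_block b b')//.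
have /set0Pn[x xb] := P0 _ bP; apply: (meetI xb).
by apply: (subsetP Tb'); apply: (subsetP ST); rewrite -E.
Qed.

Lemma argmap_neq0 W a S : S \in B -> S \subset W -> argmap W a S != set0.
Proof.
move=> SB SW; rewrite ffunE SB SW; apply: argmx_neq0.
by case: hB => B0 _ _; apply: contraTneq SB => ->.
Qed.

Lemma argmapE W a S : S \in B -> S \subset W -> argmap W a S = argmx a S.
Proof. by move=> SB SW; rewrite ffunE SB SW. Qed.

Lemma top_level_comp W a C : C \in comps B W ->
  C :&: top_level (argmap W a) W = argmap W a C.
Proof.
move=> CW; have /compsP[CB CsW _] := CW; apply/setP => i; rewrite inE.
apply/andP/idP => [[iC /bigcupP[D DW iD]]|iC].
  suff -> : C = D by [].
  apply: (comps_eq CW DW); apply: (meetI iC).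
  have /compsP[DB DsW _] := DW; move: iD; rewrite argmapE//.
  exact/subsetP/argmx_sub.
split; last by apply/bigcupP; exists C.
by move: iC; rewrite argmapE//; exact/subsetP/argmx_sub.
Qed.

Lemma top_level_hits W a : hits B W (top_level (argmap W a) W).
Proof.
apply/hitsP; split; last first.
  move=> C CW; rewrite setIC top_level_comp//; have /compsP[CB CsW _] := CW.
  exact: argmap_neq0.
apply/bigcupsP => C /compsP[CB CW _]; rewrite argmapE//.
exact: subset_trans (argmx_sub _ _) CW.
Qed.

(** Let i in S be a vertex where a is maximal over a component C of W.  Then S
    is inside C, so the maximum of a over S is its maximum over C. *)
Lemma argmap_meet W a S : S \in B -> S \subset W ->
  S :&: top_level (argmap W a) W != set0 ->
    argmap W a S = S :&: top_level (argmap W a) W.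
Proof.
move=> SB SW; case/set0Pn=> i; rewrite inE => /andP[iS /bigcupP[C CW iC]].
have /compsP[CB CsW Cm] := CW.
move: (iC); rewrite argmapE// => /argmxP[iC' imax].
have SC : S \subset C by apply: Cm => //; exact: (meetI iS iC').
have -> : S :&: top_level (argmap W a) W = S :&: argmx a C.
  by rewrite -{1}(setIidPl SC) -setIA top_level_comp// argmapE.
rewrite argmapE//; apply/setP => j; rewrite [RHS]inE; apply/argmxP/andP.
  move=> [jS jmax]; split=> //; apply/argmxP; split; first exact: (subsetP SC).
  by move=> k kC; apply: le_trans (jmax i iS); exact: imax.
case=> jS /argmxP[_ jmax]; split=> // k kS; apply: jmax; exact: (subsetP SC).
Qed.

Definition glue W A f : {ffun {set 'I_m} -> {set 'I_m}} :=
  [ffun S => if (S \in B) && (S \subset W) then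
     if S :&: A == set0 then f S else S :&: A else set0].

Definition restr_map W f : {ffun {set 'I_m} -> {set 'I_m}} :=
  [ffun S : {set 'I_m} => if S \subset W then f S else set0].

Lemma subsetD_I0 S W A : (S \subset W :\: A) =
  (S \subset W) && (S :&: A == set0).
Proof. by rewrite subsetD setI_eq0. Qed.

Lemma restr_map_argmap W A a : restr_map (W :\: A) (argmap W a) =
  argmap (W :\: A) a.
Proof.
apply/ffunP => S; rewrite !ffunE subsetD_I0.
by case: (S \subset W) => //=; rewrite ?andbF// andbT; case: (S \in B) => //=;
  case: ifP.
Qed.

Lemma glue_argmap W a : let A := top_level (argmap W a) W in
  glue W A (argmap (W :\: A) a) = argmap W a.
Proof.
move=> A; apply/ffunP => S; rewrite ffunE [RHS]ffunE.
case: ifP => // /andP[SB SW]; case: ifPn => [SA|SA].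
  by rewrite argmapE// subsetD_I0 SW.
by rewrite -argmap_meet// argmapE.
Qed.

(** To realise a face with prescribed top level A, raise the values of a' on A
    above all the others. *)
Lemma glue_real W A a' : hits B W A ->
  exists2 a, argmap W a = glue W A (argmap (W :\: A) a') &
    top_level (argmap W a) W = A.
Proof.
move=> hA; have /hitsP[AW Ahit] := hA.
(* A bound above all the values of a'. *)
pose K := 1 + \sum_i `|a' 0 i|.
have K_gt i : a' 0 i < K.
  rewrite /K; apply: (le_lt_trans (ler_norm _)).
  rewrite (bigD1 i)//= addrCA -[ltLHS]addr0 ltrD2l.
  by rewrite ltr_pwDl ?ltr01// sumr_ge0.
pose a : 'rV[R]_m := \row_i if i \in A then K else a' 0 i.
have aA S : S :&: A != set0 -> argmx a S = S :&: A.
  case/set0Pn=> k; rewrite inE => /andP[kS kA]; apply/setP => i;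
    rewrite [RHS]inE.
  apply/argmxP/andP => [[iS imax]|[iS iA]]; last first.
    by split=> // j jS; rewrite !mxE iA; case: ifP => // _; exact: ltW.
  split=> //; apply: contraT => iA; have := imax k kS.
  by rewrite !mxE kA (negPf iA) leNgt K_gt.
have aN S : S :&: A == set0 -> argmx a S = argmx a' S.
  move=> SA; have E i : i \in S -> a 0 i = a' 0 i.
    move=> iS; rewrite mxE; case: ifP => // iA.
    by have := in_set0 i; rewrite -(eqP SA) inE iS iA.
  apply/setP => i; apply/argmxP/argmxP => -[iS imax]; split=> // j jS.
    by rewrite -!E// imax.
  by rewrite !E// imax.
exists a.
  apply/ffunP => S; rewrite ffunE [RHS]ffunE; case: ifP => // /andP[SB SW].
  by case: ifP => SA; [rewrite aN// argmapE// subsetD_I0 SW|rewrite aA// SA].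
apply/setP => i; apply/bigcupP/idP => [[C CW]|iA].
  have /compsP[CB CsW _] := CW; rewrite argmapE// aA;
    last by rewrite setIC Ahit.
  by rewrite inE => /andP[].
have [C CW iC] := comps_cover hB (subsetP AW i iA); exists C => //.
have /compsP[CB CsW _] := CW.
by rewrite argmapE// aA ?inE ?iC// setIC Ahit.
Qed.

(** Each component contributes its trace on the top level as one new block. *)
Lemma blocks_step W a P : let A := top_level (argmap W a) W in
  is_blocks (argmap (W :\: A) a) (W :\: A) P ->
  is_blocks (argmap W a) W ([set argmap W a C | C in comps B W] :|: P) /\
  #|[set argmap W a C | C in comps B W] :|: P| = (#|comps B W| + #|P|)%N.
Proof.
move=> A [partP fP Pf]; have /hitsP[AW _] := top_level_hits W a.
have [/eqP cP tP P0] := and3P partP.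
have memP b : b \in P -> b \subset W :\: A.
  by move=> bP; rewrite -cP; exact: bigcup_sup.
have compA C : C \in comps B W -> argmap W a C = C :&: A.
  by move=> CW; rewrite top_level_comp.
have inj : {in comps B W &, injective (argmap W a)}.
  move=> C D CW DW E; apply: (comps_eq CW DW).
  have /compsP[CB CsW _] := CW; have /set0Pn[x xC] := argmap_neq0 a CB CsW.
  move: (xC); rewrite compA// inE => /andP[xC' _].
  by move: xC; rewrite E compA// inE => /andP[xD _]; exact: (meetI xC' xD).
have dis C b : C \in comps B W -> b \in P -> argmap W a C :&: b = set0.
  move=> CW bP; apply/eqP; rewrite -subset0; apply/subsetP => x.
  rewrite compA// !inE => /andP[/andP[_ xA] xb].
  by have := subsetP (memP b bP) x xb; rewrite inE xA.
split; last first.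
  rewrite cardUdisj ?card_in_imset//; apply/setP => b; rewrite !inE.
  apply/negbTE/negP => /andP[/imsetP[C CW E] bP].
  have := dis C b CW bP; rewrite -E setIid => b0.
  by rewrite b0 (negPf P0) in bP.
split.
- apply/and3P; split.
  + apply/eqP/setP => x; apply/bigcupP/idP => [[b]|xW].
      rewrite inE => /orP[/imsetP[C CW ->]|bP xb].
        by have /compsP[CB CsW _] := CW;
          rewrite compA// inE => /andP[/(subsetP CsW)].
      by have := subsetP (memP b bP) x xb; rewrite inE => /andP[].
    have [xA|xA] := boolP (x \in A).
      have [C CW xC] := comps_cover hB xW.
      by exists (argmap W a C); rewrite ?inE ?imset_f// compA// inE xC.
    have : x \in cover P by rewrite cP inE xA.
    by case/bigcupP => b bP xb; exists b => //; rewrite inE bP orbT.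
  + apply/trivIsetP => b b'; rewrite !inE => hb hb' bb'; rewrite -setI_eq0.
    case/orP: hb => [/imsetP[C CW Eb]|bP];
      case/orP: hb' => [/imsetP[D DW Eb']|b'P].
    * apply: contraNT bb'; rewrite Eb Eb' !compA// => /set0Pn[x].
      rewrite !inE => /andP[/andP[xC _] /andP[xD _]].
      by rewrite (comps_eq CW DW (meetI xC xD)).
    * by rewrite Eb dis.
    * by rewrite Eb' setIC dis.
    by rewrite setI_eq0; exact: (trivIsetP tP).
  rewrite inE negb_or P0 andbT; apply/negP => /imsetP[C CW E].
  have /compsP[CB CsW _] := CW.
  by have := argmap_neq0 a CB CsW; rewrite -E eqxx.
- move=> S SB SW; have [SA|SA] := boolP (S :&: A == set0).
    have SWA : S \subset W :\: A by rewrite subsetD_I0 SW.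
    have [b bP Sb] := fP S SB SWA; exists b; first by rewrite inE bP orbT.
    by move: Sb; rewrite !argmapE.
  have /set0Pn[x] := SA; rewrite inE => /andP[xS xA].
  have [C CW xC] := comps_cover hB (subsetP SW x xS).
  have /compsP[CB CsW Cm] := CW.
  exists (argmap W a C); first by rewrite inE imset_f.
  by rewrite argmap_meet// compA// setSI// Cm//; exact: meetI xC.
move=> b; rewrite inE => /orP[/imsetP[C CW ->]|/Pf[S [SB SW ->]]].
  by have /compsP[CB CsW _] := CW; exists C.
have SW' := subset_trans SW (subsetDl _ _).
by exists S; rewrite !argmapE.
Qed.

Lemma blocks_set0 f : is_blocks f set0 set0.
Proof.
split.
- by apply/and3P; split; rewrite ?inE//;
  [rewrite /cover big_set0|apply/trivIsetP => b b'; rewrite inE].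
- move=> S SB; rewrite subset0 => /eqP E.
  by case: hB => B0 _ _; rewrite -E SB in B0.
by move=> b; rewrite inE.
Qed.

Lemma argmap_blocks W a : is_blocks (argmap W a) W (blocks (argmap W a) W).
Proof.
suff [P hP] : exists P, is_blocks (argmap W a) W P.
  rewrite (is_blocksE _ hP)// => S; exact: argmap_neq0.
have [n] := ubnP #|W|; elim: n W => // n IH W Wn.
have [->|W0] := eqVneq W set0; first by exists set0; exact: blocks_set0.
have hA := top_level_hits W a; have /hitsP[AW _] := hA.
have [P hP] := IH _ (leq_trans (card_setD_lt AW (hits_neq0 hB W0 hA)) Wn).
by eexists; exact: (blocks_step hP).1.
Qed.

Lemma card_blocks_le f W P : is_blocks f W P -> (#|P| <= #|W|)%N.
Proof.
move=> [partP _ _]; rewrite -(card_transversal (transversalP partP)).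
exact/subset_leq_card/(transversal_sub (transversalP partP)).
Qed.

Definition argmaps W := [set f | `[< exists a, f = argmap W a >]].

Definition map_dim f W := (#|W| - #|blocks f W|)%N.

(** The faces of B|W with top level A are in bijection with those of
    B|(W :\: A), by restricting and gluing, and [blocks_step] gives the change
    of dimension. *)
Lemma sum_argmaps W :
  \sum_(f in argmaps W) ('X - 1 : {poly int}) ^+ map_dim f W = hnest B W.
Proof.
have [n] := ubnP #|W|; elim: n W => // n IH W Wn.
have [->|W0] := eqVneq W set0.
  rewrite hnest0// (eq_bigl (pred1 (argmap set0 0))) => [|f].
    by rewrite big_pred1_eq /map_dim cards0 sub0n.
  rewrite inE; apply/asboolP/eqP => [[a ->]|->]; last by exists 0.
  apply/ffunP => S; rewrite !ffunE subset0; case: eqP => [->|];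
    last by rewrite andbF.
  by case: hB => /negPf ->.
rewrite hnestE// (partition_big (fun f => top_level f W) (hits B W)) => [|f];
  last first.
  by rewrite inE => /asboolP[a ->]; exact: top_level_hits.
apply: eq_bigr => A hA; have /hitsP[AW _] := hA.
have A0 := hits_neq0 hB W0 hA.
rewrite -(IH _ (leq_trans (card_setD_lt AW A0) Wn)) mulr_sumr.
rewrite (reindex_onto (glue W A) (restr_map (W :\: A))) /=; last first.
  move=> f /andP[]; rewrite inE => /asboolP[a ->] /eqP EA.
  by rewrite restr_map_argmap -{1 2}EA glue_argmap.
have E f : [&& glue W A f \in argmaps W, top_level (glue W A f) W == A &
      restr_map (W :\: A) (glue W A f) == f] = (f \in argmaps (W :\: A)).
  rewrite !inE; apply/and3P/asboolP =>
    [[/asboolP[a Ea] /eqP EA /eqP <-]|[a' ->]].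
    by exists a; rewrite Ea restr_map_argmap.
  have [a Ea Et] := glue_real a' hA; split.
  - by apply/asboolP; exists a.
  - by rewrite -Ea Et.
  apply/eqP/ffunP => S; rewrite !ffunE subsetD_I0.
  case: (S \subset W) => //=; rewrite ?andbF// andbT.
  by case: (S \in B); case: (S :&: A == set0).
rewrite (eq_bigl (fun f => f \in argmaps (W :\: A))) => [|f];
  last by rewrite -E andbA.
apply: eq_bigr => f; rewrite inE => /asboolP[a' Ef]; rewrite -exprD;
  congr (_ ^+ _).
have [a Ea Et] := glue_real a' hA.
have fE : f = argmap (W :\: A) a.
  rewrite -restr_map_argmap Ea Ef; apply/ffunP => S; rewrite !ffunE subsetD_I0.
  case: (S \subset W) => //=; rewrite ?andbF// andbT.
  by case: (S \in B); case: (S :&: A == set0).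
have bl := argmap_blocks (W :\: A) a.
have [] := @blocks_step W a (blocks (argmap (W :\: A) a) (W :\: A));
  first by rewrite Et.
rewrite /map_dim -/(glue W A f) Ef -Ea -Ef fE => h1 h2.
rewrite (is_blocksE _ h1) ?h2; last by move=> S; exact: argmap_neq0.
have := card_blocks_le bl; have := hits_card hB hA.
have := subset_leq_card AW; rewrite cardsD (setIidPr AW); clear.
by move: #|blocks _ _| #|W| #|A| #|comps B W| => x y z t; lia.
Qed.

End FaceRecursion.

(** * From nestohedra to building sets *)

Section NestohedronGamma.
Variables (R : realType) (m : nat) (B : {set {set 'I_m}}).
Hypothesis hB : building_set B.
Implicit Types (S T U W A C J : {set 'I_m}) (a : 'rV[R]_m).
Local Notation NB := (nestohedron R B).

Lemma face_sum_ext (phi psi : {set 'I_m} -> {set 'I_m}) :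
  (forall S, S \in B -> phi S = psi S) ->
    @face_sum R m B phi = @face_sum R m B psi.
Proof.
move=> E; apply/funext => x; apply/propext; split=> -[y [yS ->]]; exists y.
  by split=> // S SB; rewrite -E//; exact: yS.
by split=> // S SB; rewrite E//; exact: yS.
Qed.

Lemma comps_partition W : partition (comps B W) W.
Proof.
apply/and3P; split.
- apply/eqP/setP => x; apply/bigcupP/idP => [[C /compsP[_ /subsetP CW _]]|xW].
    exact: CW.
  by have [C CW xC] := comps_cover hB xW; exists C.
- apply/trivIsetP => C D CW DW; rewrite -setI_eq0; apply: contraNT => CD.
  by rewrite (comps_eq CW DW CD).
by apply/negP => /compsP[+ _ _]; case: hB => /negPf->.
Qed.

Lemma affdim_nestohedron : affdim NB = (m - #|comps B [set: 'I_m]|)%N.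
Proof.
apply: (@affdim_face_sum R m B id) => //.
- by move=> S; exact: B_neq0.
- exact: comps_partition.
- move=> S SB; have /set0Pn[x xS] := B_neq0 hB SB.
  have [C CW xC] := comps_cover hB (in_setT x); exists C => //.
  by have /compsP[_ _ Cm] := CW; apply: Cm => //; exact: meetI xC.
by move=> C /compsP[CB _ _]; exists C.
Qed.

Lemma affdim_face a : affdim (@face_sum R m B (argmx a)) =
  map_dim B (argmap B [set: 'I_m] a) [set: 'I_m].
Proof.
have [partP fP Pf] := argmap_blocks hB [set: 'I_m] a.
rewrite /map_dim cardsT card_ord; apply: (affdim_face_sum R _ partP).
- by move=> S; exact: argmxB_neq0.
- move=> S SB; have [b bP Sb] := fP S SB (subsetT _); exists b => //.
  by rewrite argmapE ?subsetT in Sb.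
by move=> b /Pf[S [SB _ ->]]; exists S; rewrite ?argmapE ?subsetT.
Qed.

Lemma affdim_mono (P Q : set 'rV[R]_m) : (forall x, P x -> Q x) ->
  (affdim P <= affdim Q)%N.
Proof.
move=> PQ; apply/bigmax_leqP => k /asboolP[p [pf pP]].
apply: leq_bigmax_cond; apply/asboolP; exists p; split=> // i; exact: PQ.
Qed.

Local Notation faces := (argmaps R B [set: 'I_m]).
Local Notation fdim f := (map_dim B f [set: 'I_m]).

Lemma face_sum_argmap a : @face_sum R m B (argmap B [set: 'I_m] a) =
  @face_sum R m B (argmx a).
Proof. by apply: face_sum_ext => S SB; rewrite argmapE ?subsetT. Qed.

Lemma fvec_nestohedron i : fvec NB i = #|[set f in faces | fdim f == i]|.
Proof.
pose D := [set f in faces | fdim f == i].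
pose q (f : {ffun {set 'I_m} -> {set 'I_m}}) : set 'rV[R]_m := face_sum B f.
pose X := [fset q f | f in D]%fset.
have -> : fvec NB i = #|` X|%fset.
  rewrite /fvec; have -> : dfaces NB i = [set` X]%classic.
    apply/funext => F; apply/propext; split.
      move=> [/faceE H F0 dF]; have [a Ea] := H hB F0.
      rewrite /= ; apply/imfsetP; exists (argmap B [set: 'I_m] a); last first.
        by rewrite /q face_sum_argmap.
      rewrite /= !inE; apply/andP; split; first by apply/asboolP; exists a.
      by rewrite -affdim_face -Ea dF.
    move=> /imfsetP[f /=]; rewrite !inE => /andP[/asboolP[a ->] /eqP <-] ->.
    rewrite /q face_sum_argmap; split; first exact: face_sum_face.
      by apply: face_sum_neq0 => // S; exact: argmxB_neq0.
    by rewrite affdim_face.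
  by rewrite set_fsetK.
rewrite card_in_imfset ?cardE//=.
move=> f g; rewrite !inE => /andP[/asboolP[a ->] _] /andP[/asboolP[b ->] _].
rewrite /q !face_sum_argmap => E; apply/ffunP => S; rewrite !ffunE.
by case: ifP => // /andP[SB _]; exact: (face_sum_argmx_inj hB E).
Qed.

Lemma fdim_le f : f \in faces -> (fdim f <= affdim NB)%N.
Proof.
rewrite inE => /asboolP[a ->]; rewrite -affdim_face; apply: affdim_mono.
by move=> x /face_sum_argmx[].
Qed.

Lemma hpoly_nestohedron : hpoly NB = hnest B [set: 'I_m].
Proof.
rewrite -(sum_argmaps R hB) /hpoly.
rewrite (partition_big (fun f => inord (fdim f) : 'I_(affdim NB).+1) xpredT)//=.
apply: eq_bigr => i _; rewrite fvec_nestohedron scaler_nat -sumr_const.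
have E f : (f \in faces) && (inord (fdim f) == i) =
    (f \in [set f in faces | fdim f == i]).
  rewrite [RHS]inE; have [fF|//] := boolP (f \in faces).
  by rewrite -val_eqE /= inordK// ltnS fdim_le.
by apply/esym/eq_big => [f|f]; rewrite E// inE => /andP[_ /eqP ->].
Qed.

Lemma gamma_nestohedron n g : affdim NB = n ->
  has_gamma n g (hnest B [set: 'I_m]) -> gamma NB = (fun i => g`_i).
Proof.
move=> dn /has_gamma_expansion; rewrite -hpoly_nestohedron -{1}dn => hg.
rewrite /gamma; apply: (gamma_expansion_uniq _ hg).
by apply: (@xgetPex _ (fun=> -1)); exists (fun i => g`_i).
Qed.

(** Maximising the opposite of the sum of the coordinates in J selects the facet
    of the nestohedron that belongs to J. *)
Definition facet_dir J : 'rV[R]_m := \row_i - (i \in J)%:R.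

Lemma argmx_facet_dir J T : T != set0 ->
  argmx (facet_dir J) T = if T \subset J then T else T :\: J.
Proof.
move=> T0; apply/setP => i; apply/argmxP/idP => [[iT imax]|].
  case: ifPn => [//|/subsetPn[j jT jJ]]; rewrite inE iT andbT.
  have := imax j jT; rewrite !mxE (negPf jJ) oppr0 oppr_ge0.
  by case: (i \in J) => //; rewrite ler10.
case: ifPn => [/subsetP TJ iT|_]; last first.
  rewrite inE => /andP[iJ iT]; split=> // j _.
  by rewrite !mxE (negPf iJ) oppr0 oppr_le0 ler0n.
by split=> // j jT; rewrite !mxE (TJ _ iT) (TJ _ jT).
Qed.

(** The blocks of this face are J and the nonempty sets C :\: J for C a
    component, one more than there are components. *)
Lemma facet_facet_dir J S : J \in B -> S \in B -> J \proper S ->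
  facets NB (@face_sum R m B (argmx (facet_dir J))).
Proof.
move=> JB SB JS; split; first exact: face_sum_face.
  by apply: face_sum_neq0 => // T; exact: argmxB_neq0.
have J0 := B_neq0 hB JB.
set cs := comps B [set: 'I_m].
have csD C : C \in cs -> C :\: J != set0.
  move=> CW; have /compsP[CB _ Cm] := CW; rewrite setD_eq0.
  apply/negP => CJ; have /andP[sJS nSJ] := JS.
  case/negP: nSJ; apply: (subset_trans _ CJ); apply: Cm => //.
  have /set0Pn[x xC] := comps_neq0 hB CW.
  exact: (meetI (subsetP sJS _ (subsetP CJ _ xC)) xC).
have csP := comps_partition [set: 'I_m].
have inj : {in cs &, injective (fun C => C :\: J)}.
  move=> C D CW DW E; apply: (comps_eq CW DW).
  have /set0Pn[x xC] := csD _ CW; have xD : x \in D :\: J by rewrite -E.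
  by move: xC xD; rewrite !inE => /andP[_ xC] /andP[_]; exact: meetI.
pose P := J |: [set C :\: J | C in cs].
have inP C : C \in cs -> C :\: J \in P.
  by move=> CW; rewrite in_setU1 (imset_f (fun C => C :\: J) CW) orbT.
have JnP : J \notin [set C :\: J | C in cs].
  apply/imsetP => -[C CW E]; have /set0Pn[x xJ] := J0.
  by move: (xJ); rewrite E inE xJ.
have partP : partition P [set: 'I_m].
  apply/and3P; split.
  - apply/eqP/setP => x; rewrite [RHS]inE; apply/bigcupP.
    have [xJ|xJ] := boolP (x \in J); first by exists J; rewrite ?setU11.
    have [C CW xC] := comps_cover hB (in_setT x).
    by exists (C :\: J); [exact: inP|rewrite inE xJ].
  - apply/trivIsetP => b b'; rewrite !in_setU1 -setI_eq0.
    case/predU1P => [->|/imsetP[C CW ->]];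
      case/predU1P => [->|/imsetP[D DW ->]].
    + by rewrite eqxx.
    + by rewrite setIDA setIC -setIDA setDv setI0 eqxx.
    + by rewrite setIC setIDA setIC -setIDA setDv setI0 eqxx.
    apply: contraNT => /set0Pn[x];
      rewrite !inE => /andP[/andP[_ xC] /andP[_ xD]].
    by rewrite (comps_eq CW DW (meetI xC xD)).
  rewrite in_setU1 negb_or eq_sym J0 /=; apply/imsetP => -[C /csD + E].
  by rewrite -E eqxx.
have cP : #|P| = #|cs|.+1 by rewrite cardsU1 JnP card_in_imset.
have Pm : (#|P| <= m)%N.
  rewrite -(card_transversal (transversalP partP)) -[m in (_ <= m)%N]card_ord.
  exact: max_card.
rewrite (affdim_face_sum R _ partP).
- by rewrite affdim_nestohedron cP -/cs; move: Pm; rewrite cP; lia.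
- by move=> T; exact: argmxB_neq0.
- move=> T TB; rewrite argmx_facet_dir ?(B_neq0 hB TB)//.
  case: ifPn => [TJ|_]; first by exists J; rewrite ?setU11.
  have /set0Pn[x xT] := B_neq0 hB TB.
  have [C CW xC] := comps_cover hB (in_setT x).
  exists (C :\: J); first exact: inP.
  have /compsP[_ _ Cm] := CW; apply/setSD/Cm => //.
  exact: meetI xC.
move=> b; rewrite in_setU1 => /predU1P[->|/imsetP[C CW ->]].
  by exists J; rewrite // argmx_facet_dir// subxx.
have /compsP[CB _ _] := CW; exists C => //.
rewrite argmx_facet_dir ?(B_neq0 hB CB)//.
by rewrite -setD_eq0 (negPf (csD _ CW)).
Qed.

(** Take a partition of S into at least two elements of B with as few blocks as
    possible.  If it has more than two, no union of two blocks is in B, for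
    merging them would give a shorter one.  This makes the facets of any two
    blocks J and K meet: an element of B inside J :|: K must lie inside J or
    inside K.  But a common point of all these facets would have, in the summand
    of S itself, coordinates zero on every block, hence on all of S. *)
Lemma flag_splittable : flag NB -> splittable B.
Proof.
move=> flagP S SB S1.
pose good P := [&& partition P S, P \subset B & (1 < #|P|)%N].
have good0 : good [set [set x] | x in S].
  apply/and3P; split; last 1 first.
  - by rewrite card_imset//; exact: set1_inj.
  - apply/and3P; split.
    + apply/eqP/setP => x; apply/bigcupP/idP => [[_ /imsetP[y yS ->]]|xS].
        by rewrite inE => /eqP ->.
      by exists [set x]; rewrite ?set11 ?imset_f.
    + apply/trivIsetP => _ _ /imsetP[x _ ->] /imsetP[y _ ->].
      by rewrite -setI_eq0; apply: contraNT => /set0Pn[z];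
        rewrite !inE => /andP[/eqP-> /eqP->].
    by apply/imsetP => -[x _ /esym/eqP]; rewrite -cards_eq0 cards1.
  by apply/subsetP => _ /imsetP[x _ ->]; case: hB.
case: (@arg_minnP _ _ good (fun P : {set {set 'I_m}} => #|P|) good0) => P.
move=> /and3P[partP PB P1] Pmin.
have [/eqP cP tP P0] := and3P partP.
have PB' J : J \in P -> J \in B by exact: (subsetP PB).
have uniq_block J K : J \in P -> K \in P -> J :&: K != set0 -> J = K.
  move=> JP KP; apply: contra_neq_eq => JK; apply/eqP; rewrite setI_eq0.
  exact: (trivIsetP tP).
have subS J : J \in P -> J \subset S by move=> JP; rewrite -cP;
  exact: bigcup_sup.
have merge J K : J \in P -> K \in P -> J != K -> (2 < #|P|)%N ->
  J :|: K \notin B.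
  move=> JP KP JK P2; apply/negP => JKB.
  (* Replacing J and K by their union gives a shorter partition. *)
  pose P0' := P :\ J :\ K.
  have memP0 b : b \in P0' -> [/\ b \in P, b :&: J = set0 & b :&: K = set0].
    rewrite !inE => /and3P[bK bJ bP]; split=> //.
      by apply: contraNeq bJ => bJ; rewrite (uniq_block _ _ bP JP bJ).
    by apply: contraNeq bK => bK; rewrite (uniq_block _ _ bP KP bK).
  have JK0 : J :|: K != set0.
    apply: contraNneq P0 => E; suff <- : J = set0 by [].
    by apply/eqP; rewrite -subset0 -E subsetUl.
  have JKb b : b \in P0' -> (J :|: K) :&: b = set0.
    by move=> /memP0[_ bJ bK]; rewrite setIC setIUr bJ bK setU0.
  have JKn : J :|: K \notin P0'.
    by apply: contra JK0 => /JKb; rewrite setIid => ->.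
  have cP' : #|P| = #|(J :|: K) |: P0'|.+1.
    by rewrite cardsU1 JKn (cardsD1 J P) JP (cardsD1 K (P :\ J)) !inE eq_sym JK
      KP.
  have : good ((J :|: K) |: P0').
    apply/and3P; split; last by rewrite -ltnS -cP'.
      apply/and3P; split.
      - apply/eqP/setP => x; apply/bigcupP/idP => [[b]|xS].
          rewrite in_setU1 => /predU1P[->|/memP0[/subS/subsetP bS _ _]];
            last exact: bS.
          by rewrite inE => /orP[]; exact/subsetP/subS.
        have : x \in cover P by rewrite cP.
        case/bigcupP=> b bP xb.
        have [bJ|bJ] := eqVneq b J.
          by exists (J :|: K); rewrite ?setU11// inE -bJ xb.
        have [bK|bK] := eqVneq b K.
          by exists (J :|: K); rewrite ?setU11// inE -bK xb orbT.
        by exists b; rewrite // !inE bJ bK bP orbT.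
      - apply/trivIsetP => b b'; rewrite !in_setU1 -setI_eq0.
        case/predU1P => [->|bP]; case/predU1P => [->|b'P].
        + by rewrite eqxx.
        + by rewrite JKb.
        + by rewrite setIC JKb.
        have [bP' _ _] := memP0 _ bP; have [b'P' _ _] := memP0 _ b'P.
        by apply: contraNT => /(uniq_block _ _ bP' b'P') ->.
      rewrite in_setU1 negb_or eq_sym JK0 /=; apply/negP => /memP0[].
      by rewrite (negPf P0).
    rewrite subUset sub1set JKB /=; apply/subsetP => b /memP0[bP _ _].
    exact: PB'.
  by move/Pmin; rewrite /= cP' ltnn.
have [P2|P2] := leqP #|P| 2.
  have /cards2P[J [K [JK EP]]] : #|P| == 2%N by rewrite eqn_leq P2 P1.
  have JP : J \in P by rewrite EP !inE eqxx.
  have KP : K \in P by rewrite EP !inE eqxx orbT.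
  exists J, K; split; [exact: PB'|exact: PB'| |].
    by apply: contraNeq JK => JK; rewrite (uniq_block _ _ JP KP JK).
  by rewrite -cP /cover EP big_setU1 ?inE//= big_set1.
have properS J : J \in P -> J \proper S.
  move=> JP; rewrite properEneq subS// andbT; apply: contraTneq P1 => E.
  rewrite -leqNgt; apply: (@leq_trans #|[set J]|); last by rewrite cards1.
  apply/subset_leq_card/subsetP => K KP; rewrite inE; apply/eqP.
  apply: uniq_block => //; rewrite E (setIidPl (subS _ KP)).
  by apply: contraNneq P0 => <-.
pose Fc J : set 'rV[R]_m := face_sum B (argmx (facet_dir J)).
have [| |x xF] := flagP [set F | exists2 J, J \in P & F = Fc J]%classic.
- move=> _ [J JP ->]; exact: (facet_facet_dir (PB' _ JP) SB (properS _ JP)).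
- move=> _ _ [J JP ->] [K KP ->].
  (* The two faces meet if their functionals have, on each element of B, a
     common maximum. *)
  suff [x xQ] : exists x, @face_sum R m B
      (fun T => argmx (facet_dir J) T :&: argmx (facet_dir K) T) x.
    exists x; split.
      by case: xQ => y [yS ->]; exists y; split=> // T /yS;
        apply/simplexS/subsetIl.
    by case: xQ => y [yS ->]; exists y; split=> // T /yS;
      apply/simplexS/subsetIr.
  apply: face_sum_neq0 => T TB; have T0 := B_neq0 hB TB.
  have [->|JK] := eqVneq J K; first by rewrite setIid; apply: argmx_neq0.
  have sub a : T :&: argmx a T = argmx a T by apply/setIidPr; exact: argmx_sub.
  rewrite (argmx_facet_dir J T0); case: ifPn => [_|TJ].
    by rewrite sub; apply: argmx_neq0.
  rewrite (argmx_facet_dir K T0); case: ifPn => [TK|TK].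
    by rewrite (setIidPl (subsetDl _ _)) setD_eq0.
  rewrite -setDUr setD_eq0; apply: contra (merge J K JP KP JK P2) => TJK.
  have [_ _ BU] := hB.
  have meet U V : T \subset U :|: V -> ~~ (T \subset U) -> T :&: V != set0.
    move=> /subsetP TUV /subsetPn[z zT zU]; apply: (meetI zT).
    by have := TUV z zT; rewrite inE (negPf zU).
  have TJ' : T :&: J != set0 by apply: meet TK; rewrite setUC.
  have TK' : T :&: K != set0 by exact: meet TJ.
  have <- : (T :|: J) :|: K = J :|: K by rewrite -setUA; apply/setUidPr.
  apply: (BU); [by apply: (BU) => //; exact: PB'|exact: PB'|].
  by case/set0Pn: TK' => z; rewrite inE => /andP[zT zK]; apply: (meetI _ zK);
    rewrite inE zT.
have /set0Pn[J0 J0P] : P != set0 by rewrite -card_gt0 ltnW.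
have /face_sum_argmx[[y [yT Ex]] _] : Fc J0 x by apply: xF; exists J0.
have /std_simplexP[_ yS y1] := yT S SB.
(* One decomposition of x serves for all the facets at once. *)
have y0 i : y S 0 i = 0.
  have [iS|/yS //] := boolP (i \in S).
  have : i \in cover P by rewrite cP.
  case/bigcupP=> J JP iJ.
  have /face_sum_argmx[_ dE] : Fc J x by apply: xF; exists J.
  have := (dot_nest_max (facet_dir J) yT).2; rewrite -Ex => /(_ dE S SB).
  rewrite argmx_facet_dir ?(B_neq0 hB SB)//.
  have /andP[_ /negPf ->] := properS _ JP.
  by case/std_simplexP=> _ + _; apply; rewrite inE iJ.
by move: y1; rewrite big1// => /esym/eqP; rewrite oner_eq0.
Qed.
End NestohedronGamma.

(** * The bounds *)

Theorem theorem2 (R : realType) (m n : nat) (B : {set {set 'I_m}}) :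
  building_set B ->
  flag (nestohedron R B) ->
  affdim (nestohedron R B) = n ->
  forall i : nat, (i <= n./2)%N ->
    0 <= gamma (nestohedron R B) i <= gamma (permutohedron R n) i.
Proof.
move=> hB flagB dn i _.
have [g [hg g0 gle]] := nest_gamma [set: 'I_m] hB (flag_splittable hB flagB).
rewrite cardsT card_ord -(affdim_nestohedron R hB) dn in hg gle.
rewrite (gamma_nestohedron hB dn hg).
have hF := full_building n.+1.
have TF : [set: 'I_n.+1] \in full_building_set n.+1.
  by rewrite inE -card_gt0 cardsT card_ord.
have dF : affdim (permutohedron R n) = n.
  by rewrite (affdim_nestohedron R hF) comps_conn// cards1 subn1.
have hP : has_gamma n (gammaPe n)
  (hnest (full_building_set n.+1) [set: 'I_n.+1]).
  have x0 : ord0 \notin [set: 'I_n.+1] :\ ord0 by rewrite !inE eqxx.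
  have := has_gamma_full x0; rewrite setD1K ?in_setT//.
  suff -> : #|[set: 'I_n.+1] :\ ord0| = n by [].
  have := cardsD1 ord0 [set: 'I_n.+1].
  by rewrite cardsT card_ord inE add1n => -[].
rewrite /permutohedron (gamma_nestohedron hF dF hP).
by have := g0 i; rewrite coef0 => ->; exact: gle.
Qed.
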